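(* Let $4<b<8$, let $F(x,y)=(|x|-y-1,\;x-|y|+b)$, let $\Gamma$ be its compact invariant graph, and let $h_F(b)$ be the topological entropy of $F|_\Gamma$. For integers $n\ge0$ let $$p_n=\frac{4(4\cdot4^{n+1}-1)}{2\cdot4^{n+1}+1},\quad q_n=\frac{8\cdot4^{n+1}+1}{4^{n+1}+2},\quad r_n=\frac{16\cdot4^{n+1}-1}{2\cdot4^{n+1}+4},\quad s_n=\frac{2(4\cdot4^{n+2}-1)}{4^{n+2}+11},$$ $p_{-1}=4$, and $S_n=(p_{n-1},s_n)$, $T_n=[s_n,r_n]$, $U_n=(r_n,q_n)$, $V_n=[q_n,p_n]$ (these intervals, over $n\ge 0$, partition $(4,8)$). Then $h_F(b)>0$ for every $b\in(4,8)$, and for every $n\ge0$: (a) If $b\in S_n$, then $\ln(\alpha_n)\le h_F(b)\le\ln(\beta_n)$, where $\alpha_n$ and $\beta_n$ are the unique positive roots of $\lambda^{7+3n}-\lambda^{4+3n}-1$ and $\lambda^{7+3n}-\lambda^{4+3n}-\lambda^3-2$, respectively. (b) If $b\in T_n$, then $h_F(b)=\ln(\delta_n)$, where $\delta_n$ is the unique positive root of $\lambda^{7+3n}-\lambda^{4+3n}-2$. (c) If $b\in U_n$, then $\ln(\alpha_n)\le h_F(b)\le\ln(\gamma_n)$, where $\gamma_n$ is the unique positive root of $\lambda^{10+3n}-\lambda^{7+3n}-2\lambda^3-1$. (d) If $b\in V_n$, then $h_F(b)=\ln(\varphi_n)$, where $\varphi_n$ is the unique positive root of $\lambda^{10+3n}-\lambda^{7+3n}-\lambda^3-1$.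 Furthermore, $1<\alpha_n<\varphi_n<\delta_n<\gamma_n<\beta_n$ for all $n\ge 0$, and each of the five sequences $(\alpha_n),(\beta_n),(\gamma_n),(\delta_n),(\varphi_n)$ is decreasing and tends to $1$ as $n\to\infty$; hence the entropy of $F|_\Gamma$ for $b$ in $S_n$, $T_n$, $U_n$, $V_n$ tends to $0$ as $n\to\infty$, and consequently $\lim_{b\to8^-}h_F(b)=0$.
   Context: The compact invariant graph $\Gamma=\Gamma_{-1,b}$ (which eventually captures all orbits of $F$ apart from those landing on an exceptional fixed point) is, for $4<b<8$, the union of the five closed segments $$\overline{P_3P_{11}},\quad \overline{P_3P_5},\quad \overline{P_6P_8},\quad \overline{P_8P_{10}},\quad \overline{P_9P_{11}},$$ where $P_3=(-b-2,-1)$, $P_5=(b,-1)$, $P_6=(b+2,-3)$, $P_8=(0,b-1)$, $P_9=(b+4,2b-1)$, $P_{10}=(b,2b-1)$, $P_{11}=(b-2,2b-1)$. One has $F(\Gamma)\subset\Gamma$. Topological entropy is the usual topological entropy of a continuous self-map of a compact metric space. *)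

(* Defs.v *)
From HB Require Import structures.
From mathcomp Require Import all_boot all_order all_algebra finmap.
From mathcomp Require Import all_classical all_reals all_analysis.
From mathcomp Require Import ring lra.

Set Implicit Arguments.
Unset Strict Implicit.
Unset Printing Implicit Defensive.

Import Order.TTheory GRing.Theory Num.Theory.
Import numFieldNormedType.Exports.

Local Open Scope classical_set_scope.
Local Open Scope ring_scope.

Section entropy.
Context {R : realType} {T : pseudoMetricType R}.
Implicit Types (f : T -> T) (K : set T) (n : nat) (e : R).

(* (n, e)-separation: distinct points of E are at distance at least e for the
   n-th Bowen metric max_{i < n} d(f^i x, f^i y). *)
Definition bowen_separated f n e (E : {fset T}) : Prop :=
  forall x y, x \in E -> y \in E -> x != y ->
    exists2 i, (i < n)%N & ~ ball (iter i f x) e (iter i f y).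

Definition max_separated f K n e : \bar R :=
  ereal_sup [set (#|` E|)%:R%:E |
              E in [set E : {fset T} | [set` E] `<=` K /\ bowen_separated f n e E]].

(* Bowen's definition of the topological entropy of the restriction of f to K.
   It is meant for K compact and f continuous with f @` K `<=` K; distances in
   K are those of the ambient space. *)
Definition topological_entropy f K : \bar R :=
  lim (limn_esup (fun n => n%:R^-1%:E * lne (max_separated f K n e))%E
         @[e --> 0^'+]).

End entropy.

Section map.
Context {R : realType}.
Implicit Types (b : R) (P Q : R * R).

Definition F b P : R * R := (`|P.1| - P.2 - 1, P.1 - `|P.2| + b).

Definition segment P Q : set (R * R) :=
  [set ((1 - t) * P.1 + t * Q.1, (1 - t) * P.2 + t * Q.2) | t in `[0, 1]].

Definition P3 b : R * R := (- b - 2, - 1).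
Definition P5 b : R * R := (b, - 1).
Definition P6 b : R * R := (b + 2, - 3).
Definition P8 b : R * R := (0, b - 1).
Definition P9 b : R * R := (b + 4, 2 * b - 1).
Definition P10 b : R * R := (b, 2 * b - 1).
Definition P11 b : R * R := (b - 2, 2 * b - 1).

Definition Gamma b : set (R * R) :=
  segment (P3 b) (P11 b) `|` segment (P3 b) (P5 b) `|`
  segment (P6 b) (P8 b) `|` segment (P8 b) (P10 b) `|`
  segment (P9 b) (P11 b).

Definition h_F b : \bar R := topological_entropy (F b) (Gamma b).

End map.

Section parameters.
Variable R : realType.
Implicit Type n : nat.

Definition p_ n : R := 4 * (4 * 4 ^+ n.+1 - 1) / (2 * 4 ^+ n.+1 + 1).
Definition q_ n : R := (8 * 4 ^+ n.+1 + 1) / (4 ^+ n.+1 + 2).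
Definition r_ n : R := (16 * 4 ^+ n.+1 - 1) / (2 * 4 ^+ n.+1 + 4).
Definition s_ n : R := 2 * (4 * 4 ^+ n.+2 - 1) / (4 ^+ n.+2 + 11).

(* p_{n-1}, with the convention p_{-1} = 4. *)
Definition p_pred n : R := if n is m.+1 then p_ m else 4.

Definition S_ n : set R := `]p_pred n, s_ n[.
Definition T_ n : set R := `[s_ n, r_ n].
Definition U_ n : set R := `]r_ n, q_ n[.
Definition V_ n : set R := `[q_ n, p_ n].

Definition STUV (k : nat * 'I_4) : set R :=
  nth set0 [:: S_ k.1; T_ k.1; U_ k.1; V_ k.1] k.2.

End parameters.

Section roots.
Context {R : realType}.

Definition unique_positive_root (p : {poly R}) (x : R) : Prop :=
  [/\ 0 < x, root p x & forall y, 0 < y -> root p y -> y = x].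

End roots.

Section invariance.
Context {R : realType}.
Implicit Types (b : R) (P Q X : R * R).

Let segmentC P Q : segment P Q `<=` segment Q P.
Proof.
move=> X [t]; rewrite /= in_itv/= => /andP[t0 t1] <-.
exists (1 - t); first by rewrite /= in_itv/=; apply/andP; split; lra.
by congr pair; ring.
Qed.

Let segmentI P Q X : P.1 < Q.1 -> P.1 <= X.1 <= Q.1 ->
  (X.2 - P.2) * (Q.1 - P.1) = (X.1 - P.1) * (Q.2 - P.2) -> segment P Q X.
Proof.
case: P Q X => [p1 p2] [q1 q2] [x1 x2]/= pq /andP[px xq] e.
have d0 : 0 < q1 - p1 by rewrite subr_gt0.
have dn0 : q1 - p1 != 0 by rewrite gt_eqF.
exists ((x1 - p1) / (q1 - p1)).
  by rewrite /= in_itv/= divr_ge0 ?ler_pdivrMr//; lra.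
rewrite /=; congr pair; first by field.
have -> : x2 = p2 + (x1 - p1) * (q2 - p2) / (q1 - p1).
  by rewrite -e mulfK// addrC subrK.
by field.
Qed.

Lemma F_Gamma b : 4 < b < 8 -> F b @` Gamma b `<=` Gamma b.
Proof.
move=> /andP[b4 b8] _ [X GX <-].
have S3_11 Y : - b - 2 <= Y.1 <= b - 2 -> Y.2 = Y.1 + b + 1 -> Gamma b Y.
  by move=> ? e; do 4 left; apply: segmentI => //=; rewrite ?e; [lra|ring].
have S3_5 Y : - b - 2 <= Y.1 <= b -> Y.2 = - 1 -> Gamma b Y.
  by move=> ? e; do 3 left; right; apply: segmentI => //=; rewrite ?e; [lra|ring].
have S6_8 Y : 0 <= Y.1 <= b + 2 -> Y.2 = b - 1 - Y.1 -> Gamma b Y.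
  by move=> ? e; do 2 left; right; apply/segmentC/segmentI => //=;
    rewrite ?e; [lra|ring].
have S8_10 Y : 0 <= Y.1 <= b -> Y.2 = Y.1 + b - 1 -> Gamma b Y.
  by move=> ? e; left; right; apply: segmentI => //=; rewrite ?e; [lra|ring].
have S9_11 Y : b - 2 <= Y.1 <= b + 4 -> Y.2 = 2 * b - 1 -> Gamma b Y.
  by move=> ? e; right; apply/segmentC/segmentI => //=; rewrite ?e; [lra|ring].
case: X GX => x y.
case=> [[[[]|]|]|] [t]; rewrite /= in_itv/= => /andP[t0 t1] [xE' yE'];
  rewrite /F/=; have tb0 : 0 <= t * b by rewrite mulr_ge0//; lra.
all: have tbb : t * b <= b by rewrite ler_piMl//; lra.
- have yE : y = x + b + 1 by lra.
  have xge : - b - 2 <= x by lra.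
  have xle : x <= b - 2 by lra.
  case: (ltrP y 0) => y0; case: (ltrP x 0) => x0.
  + by rewrite ltr0_norm// ltr0_norm//; apply: S6_8 => /=; lra.
  + lra.
  + by rewrite ltr0_norm// ger0_norm//; apply: S3_5 => /=; lra.
  + by rewrite ger0_norm// ger0_norm//; apply: S3_5 => /=; lra.
- have yE : y = - 1 by lra.
  have xge : - b - 2 <= x by lra.
  have xle : x <= b by lra.
  rewrite yE normrN1; case: (ltrP x 0) => x0.
  + by rewrite ltr0_norm//; apply: S6_8 => /=; lra.
  + by rewrite ger0_norm//; apply: S8_10 => /=; lra.
- have yE : y = b - 1 - x by lra.
  have x0 : 0 <= x by lra.
  have xle : x <= b + 2 by lra.
  rewrite (ger0_norm x0); case: (ltrP y 0) => y0.
  + by rewrite ltr0_norm//; apply: S9_11 => /=; lra.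
  + by rewrite ger0_norm//; apply: S3_11 => /=; lra.
- have yE : y = x + b - 1 by lra.
  have x0 : 0 <= x by lra.
  by rewrite !ger0_norm//; [apply: S3_11 => /=; lra|lra].
- have yE : y = 2 * b - 1 by lra.
  have xge : b - 2 <= x by lra.
  have xle : x <= b + 4 by lra.
  by rewrite !ger0_norm//; [apply: S3_11 => /=; lra|lra|lra].
Qed.

End invariance.

(* Main.v *)
Require Import Defs.
From HB Require Import structures.
From mathcomp Require Import all_boot all_order all_algebra finmap.
From mathcomp Require Import all_classical all_reals all_analysis.
From mathcomp Require Import ring lra zify.

Import Order.TTheory GRing.Theory Num.Theory.
Import numFieldNormedType.Exports.

Local Open Scope classical_set_scope.
Local Open Scope ring_scope.

(* Write [U u] for the point of P3P11 of abscissa [- u], [0 <= u <= b + 2].  Every orbit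
   in Gamma that avoids the pieces on which some iterate of F is constant returns to
   these points, and the return map is piecewise affine of slope +-4: it is
   [u |-> b - 4 + 4 * u] on [[0, 3 / 2]] (4 steps of F), [u |-> 4 * u - b - 4] on
   [[(b + 4) / 4, (b + 2) / 2]] (3 steps), [u |-> 5 * b + 4 - 4 * u] on
   [[b + 1, b + 2]] (3 steps), and constant in between.  In the interval with index n,
   the image [b - 4] of the endpoint [b + 2] leaves the second branch after n returns,
   so that [U (b - 4) b] is spread over a large arc in 3n steps.  This yields an arc
   that is covered, up to flat pieces, by three expanding branches onto itself with
   return times t1, t2, t3; hence the numbers of separated points satisfy
   [s_N = s_(N - t1) + s_(N - t2) + s_(N - t3) + O(1)] and grow like x^N, where
   [x ^- t1 + x ^- t2 + x ^- t3 = 1].  The return times (3, 3n + 7, 3n + 10) give phi_n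
   (for V_n, and as a lower bound for every b), and (3, 3n + 7, 3n + 7) give delta_n
   (for T_n, and as an upper bound for U_n); on S_n the times (3, 3n + 4, 3n + 7) give
   an upper bound. *)

Local Ltac lia_nat := repeat match goal with
  H : ?T |- _ =>
    lazymatch T with nat => fail | is_true (_ <= _)%N => fail | _ => clear H end
  end; lia.

(** * Entropy and growth of separated sets *)

Section entropy_growth.
Context {R : realType} {T : pseudoMetricType R}.
Implicit Types (f : T -> T) (K : set T) (n : nat) (e l : R).

(** A real bound instead of a supremum in [\bar R]: it carries finiteness along, and bounds can be
    added and scaled in recursions. *)
Definition sep_bound f K n e (m : R) : Prop := forall E : {fset T},
  [set` E] `<=` K -> bowen_separated f n e E -> (#|` E|)%:R <= m.

Lemma max_separated_le f K n e m :
  sep_bound f K n e m -> (max_separated f K n e <= m%:E)%E.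
Proof.
by move=> h; apply: ge_ereal_sup => _ [E [EK sE] <-]; rewrite lee_fin; exact: h.
Qed.

Lemma max_separated_ge0 f K n e : (0 <= max_separated f K n e)%E.
Proof.
apply: le_ereal_sup_tmp; exists 0%:E => //; exists fset0; last by rewrite cardfs0.
by split => [x|x y]; rewrite /= inE.
Qed.

Lemma max_separated_anti f K n e e' : e <= e' ->
  (max_separated f K n e' <= max_separated f K n e)%E.
Proof.
move=> ee'; apply: ereal_sup_le => _ [E [EK sE] <-]; exists E => //; split => //.
move=> x y xE yE xy; have [i ni nb] := sE _ _ xE yE xy; exists i => //.
by move=> h; apply: nb; exact: le_ball h.
Qed.

Lemma le_lne (x y : \bar R) : (0 <= x)%E -> (x <= y)%E -> (lne x <= lne y)%E.
Proof.
by move=> x0 xy; rewrite lee_lne// in_itv/= leey andbT// (le_trans x0).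
Qed.

Let rate f K e n : \bar R := (n%:R^-1%:E * lne (max_separated f K n e))%E.

Let limn_esup_rate_anti f K e e' : e <= e' ->
  (limn_esup (rate f K e') <= limn_esup (rate f K e))%E.
Proof.
move=> ee'; apply: le_ereal_inf_tmp => _ [V FV <-].
apply: (@le_trans _ _ (ereal_sup (rate f K e' @` V))).
  by apply: ereal_inf_lbound; exists V.
apply: ge_ereal_sup => _ [n Vn <-]; apply: le_ereal_sup_tmp.
exists (rate f K e n); first by exists n.
apply: lee_wpmul2l; first by rewrite lee_fin invr_ge0.
by apply: le_lne; [exact: max_separated_ge0|exact: max_separated_anti].
Qed.

(** The rate is monotone in the scale [e], so the limit defining the entropy exists and can be
    estimated termwise. *)
Let is_cvg_rate f K : cvg (limn_esup (rate f K e) @[e --> 0^'+]).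
Proof.
apply: nonincreasing_at_right_is_cvge; near=> x => a b _ _ ab.
exact: limn_esup_rate_anti.
Unshelve. all: by end_near. Qed.

Lemma topological_entropy_le f K l : 0 < l ->
  (forall e, 0 < e -> exists C, forall n, sep_bound f K n e (C * l ^+ n)) ->
  (topological_entropy f K <= (ln l)%:E)%E.
Proof.
move=> l0 H; rewrite /topological_entropy; apply: lime_le; first exact: is_cvg_rate.
near=> e; have e0 : 0 < e by near: e; exact: nbhs_right_gt.
have [C HC] := H e e0.
(* [C] may be zero or negative; [D] dominates it and has a meaningful logarithm. *)
pose D := `|C| + 1; have D0 : 0 < D by rewrite ltr_wpDl.
apply/lee_addgt0Pr => d d0.
(* From [N] on, the contribution [ln D / n] of the constant is at most [d]. *)
pose N := (Num.Def.archi_bound (`|ln D| / d)).+1.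
apply: (@le_trans _ _ (ereal_sup (rate f K e @` [set n | (N <= n)%N]))).
  by apply: ereal_inf_lbound; exists [set n | (N <= n)%N] => //; exists N.
apply: ge_ereal_sup => _ [n /= Nn <-].
have n0 : 0 < n%:R :> R by rewrite ltr0n (leq_trans _ Nn).
apply: (@le_trans _ _ (n%:R^-1%:E * (ln D + ln l *+ n)%:E)%E).
  apply: lee_wpmul2l; first by rewrite lee_fin invr_ge0 ltW.
  rewrite -lnXn// -lnM ?posrE ?exprn_gt0// -lne_EFin; last first.
    by rewrite mulr_gt0// exprn_gt0.
  apply: le_lne; first exact: max_separated_ge0.
  apply: le_trans (max_separated_le _ _ _ _ _ (HC n)) _; rewrite lee_fin.
  apply: ler_wpM2r; first by rewrite exprn_ge0// ltW.
  by rewrite (le_trans (ler_norm C))// lerDl.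
rewrite -EFinM -EFinD lee_fin mulrDr -[X in _ + _ * X]mulr_natl mulKf ?gt_eqF//.
rewrite addrC lerD2l mulrC ler_pdivrMr// mulrC -ler_pdivrMr//.
apply: (@le_trans _ _ (`|ln D| / d)).
  by rewrite ler_wpM2r ?ler_norm// invr_ge0 ltW.
apply/ltW/(lt_le_trans (archi_boundP _)); first by rewrite divr_ge0// ltW.
by rewrite ler_nat (leq_trans _ Nn).
Unshelve. all: by end_near. Qed.

(** A single scale suffices, since the rates only grow as the scale shrinks. *)
Lemma topological_entropy_ge f K l e : 0 < e -> 0 < l ->
  (exists2 c, 0 < c & forall n, exists2 E : {fset T},
    [set` E] `<=` K /\ bowen_separated f n e E & c * l ^+ n <= (#|` E|)%:R) ->
  ((ln l)%:E <= topological_entropy f K)%E.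
Proof.
move=> e0 l0 [c c0 H]; rewrite /topological_entropy.
apply: lime_ge; first exact: is_cvg_rate.
near=> e1; have de : e1 <= e by near: e1; exact: nbhs_right_le.
apply: le_trans (limn_esup_rate_anti f K _ _ de).
apply/lee_subgt0Pr => d d0.
apply: le_ereal_inf_tmp => _ [V [M _ MV] <-].
pose n := (maxn M (Num.Def.archi_bound (`|ln c| / d))).+1.
apply: le_ereal_sup_tmp; exists (rate f K e n).
  by exists n => //; apply: MV; rewrite /= /n leqW ?leq_maxl.
have n0 : 0 < n%:R :> R by rewrite ltr0n.
apply: (@le_trans _ _ (n%:R^-1%:E * (ln c + ln l *+ n)%:E)%E); last first.
  apply: lee_wpmul2l; first by rewrite lee_fin invr_ge0 ltW.
  have p0 : 0 < c * l ^+ n by rewrite mulr_gt0// exprn_gt0.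
  rewrite -lnXn// -lnM ?posrE ?exprn_gt0// -lne_EFin//.
  apply: le_lne; first by rewrite lee_fin ltW.
  have [E EK cE] := H n; apply: le_ereal_sup_tmp.
  by exists (#|` E|%:R)%:E; [exists E|rewrite lee_fin].
rewrite -EFinM -EFinB lee_fin mulrDr -[X in _ + _ * X]mulr_natl mulKf ?gt_eqF//.
rewrite addrC lerD2r mulrC ler_pdivlMr// mulrC mulrN lerNl.
apply: (@le_trans _ _ `|ln c|); first by rewrite -[leRHS]normrN ler_norm.
rewrite -ler_pdivrMr//; apply: ltW; apply: (lt_le_trans (archi_boundP _)); first by rewrite divr_ge0// ltW.
by rewrite ler_nat /n leqW ?leq_maxr.
Unshelve. all: by end_near. Qed.

End entropy_growth.

(** * Upper bounds for separated sets *)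

Section sep_bound.
Context {R : realType} {T : pseudoMetricType R}.
Variables (f : T -> T) (e : R).
Hypothesis e0 : 0 < e.
Implicit Types (J K : set T) (n : nat) (m : R).

Lemma sep_boundS J K n m : J `<=` K -> sep_bound f K n e m -> sep_bound f J n e m.
Proof. by move=> JK sK E EJ; apply: sK => x /EJ /JK. Qed.

Lemma sep_bound_le J n m m' : m <= m' -> sep_bound f J n e m -> sep_bound f J n e m'.
Proof. by move=> mm' sJ E EJ sE; exact: le_trans (sJ E EJ sE) mm'. Qed.

Lemma sep_boundU J J1 J2 n m1 m2 : J `<=` J1 `|` J2 ->
  sep_bound f J1 n e m1 -> sep_bound f J2 n e m2 -> sep_bound f J n e (m1 + m2).
Proof.
move=> JU s1 s2 E EJ sE.
pose E1 := [fset x in E | `[< J1 x >]]%fset.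
pose E2 := [fset x in E | `[< J2 x >]]%fset.
have sub (E' : {fset T}) : (E' `<=` E)%fset -> bowen_separated f n e E'.
  by move=> /fsubsetP E'E x y /E'E xE /E'E yE; exact: sE.
have EE : (#|` E| <= #|` E1| + #|` E2|)%N.
  apply: leq_trans (leq_card_fsetU E1 E2); apply: fsubset_leq_card.
  apply/fsubsetP => x xE; rewrite !inE/= xE/=.
  by apply/orP; case: (JU _ (EJ _ xE)) => ?; [left|right]; exact/asboolP.
rewrite (le_trans (y := (#|` E1| + #|` E2|)%:R)) ?ler_nat// natrD lerD//.
- apply: s1; first by move=> x /=; rewrite !inE => /andP[_ /asboolP].
  by apply: sub; apply/fsubsetP => x; rewrite !inE => /andP[].
- apply: s2; first by move=> x /=; rewrite !inE => /andP[_ /asboolP].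
  by apply: sub; apply/fsubsetP => x; rewrite !inE => /andP[].
Qed.

(** No separation is lost under [f]: a pair separated at time 0 is still separated at time 1. So [f]
    is injective on [E], and its image is separated over a window shorter by one; [0 < n] leaves
    room for that time 1. *)
Lemma sep_bound_step J K n m : (0 < n)%N -> f @` J `<=` K ->
  (forall x y, J x -> J y -> ball (f x) e (f y) -> ball x e y) ->
  sep_bound f K n e m -> sep_bound f J n.+1 e m.
Proof.
move=> n0 JK fJ sK E EJ sE.
have finj : {in E &, injective f}.
  move=> x y xE yE fxy; apply/eqP/negPn/negP => xy.
  have [[|i] _] := sE _ _ xE yE xy; last by rewrite !iterSr fxy; apply; exact: ballxx.
  by apply; apply: fJ; [exact: EJ|exact: EJ|rewrite fxy; exact: ballxx].
have <- : #|` (f @` E)%fset| = #|` E| by apply/eqP/card_in_imfsetP.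
apply: sK => [_ /imfsetP[/= x xE ->]|_ _ /imfsetP[/= x xE ->] /imfsetP[/= y yE ->] fxy].
  by apply: JK; exists x => //; exact: EJ.
have xy : x != y by apply: contra fxy => /eqP ->.
have [[|i] iN h] := sE _ _ xE yE xy; last by exists i => //; rewrite -!iterSr.
by exists 0%N => //= h'; apply: h; apply: fJ => //; exact: EJ.
Qed.

(** After one step all orbits coincide, so only time 0 can separate. *)
Lemma sep_bound_flat J n m : (forall x y, J x -> J y -> f x = f y) ->
  sep_bound f J 1 e m -> sep_bound f J n e m.
Proof.
move=> fJ s1 E EJ sE; apply: s1 => // x y xE yE xy; exists 0%N => //.
have [[|i] _ //] := sE _ _ xE yE xy.
by rewrite !iterSr (fJ x y) => [[]||]; [exact: ballxx|exact: EJ|exact: EJ].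
Qed.

(** The linear recursion with delays [t1], [t2], [t3] has the supersolution [y^-1 ^+ n]; the
    additive [C] does not change the exponential rate. *)
Lemma sep_bound_growth J t1 t2 t3 (y C : R) :
  0 < y <= 1 -> y ^+ t1 + y ^+ t2 + y ^+ t3 <= 1 ->
  (0 < t1)%N -> (0 < t2)%N -> (0 < t3)%N ->
  (forall n, exists m, sep_bound f J n e m) ->
  (forall n m1 m2 m3, (t1 + t2 + t3 < n)%N ->
     sep_bound f J (n - t1) e m1 -> sep_bound f J (n - t2) e m2 ->
     sep_bound f J (n - t3) e m3 -> sep_bound f J n e (m1 + m2 + m3 + C)) ->
  exists A, forall n, sep_bound f J n e (A * y^-1 ^+ n).
Proof.
move=> /andP[y0 y1] yt t10 t20 t30 /choice[g gP] H; pose t := (t1 + t2 + t3)%N.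
(* Large enough to cover all the initial cases [n <= t], including the correction subtracted
   below. *)
pose A := \sum_(i < t.+1) `|g i| + `|C|.
have l1 : 1 <= y^-1 by rewrite invf_ge1.
have A0 : 0 <= A by rewrite addr_ge0// sumr_ge0.
have yl n k : (k <= n)%N -> y^-1 ^+ (n - k) = y ^+ k * y^-1 ^+ n.
  move=> kn; rewrite -[in RHS](subnK kn) exprD mulrCA -exprMn mulfV ?gt_eqF//.
  by rewrite expr1n mulr1.
(* The strengthened bound is inductive: the three terms bring [- 3 * |C| / 2], and adding [C] leaves
   at most [- |C| / 2]. *)
suff key n : sep_bound f J n e (A * y^-1 ^+ n - `|C| / 2).
  by exists A => n; apply: sep_bound_le (key n); rewrite gerBl.
elim/ltn_ind: n => n ih; have [nt|tn] := leqP n t.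
  apply: sep_bound_le (gP n).
  have gn : g n <= \sum_(i < t.+1) `|g i|.
    rewrite (bigD1 (Ordinal (n:=t.+1) (m:=n) nt))//=.
    by rewrite (le_trans (ler_norm _))// lerDl sumr_ge0.
  have : A <= A * y^-1 ^+ n by rewrite ler_peMr// exprn_ege1.
  by move: gn; rewrite /A; have := normr_ge0 C; lra.
apply: sep_bound_le (H n _ _ _ tn (ih _ _) (ih _ _) (ih _ _)); last 3 first.
- by rewrite /t in tn; lia_nat.
- by rewrite /t in tn; lia_nat.
- by rewrite /t in tn; lia_nat.
rewrite !yl; [|rewrite /t in tn; lia_nat..].
have : A * y^-1 ^+ n * (y ^+ t1 + y ^+ t2 + y ^+ t3) <= A * y^-1 ^+ n * 1.
  by rewrite ler_wpM2l// mulr_ge0// exprn_ge0// invr_ge0 ltW.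
by have := ler_norm C; lra.
Qed.

End sep_bound.

(** * Construction of large separated sets *)

Section separated_growth.
Context {R : realType} {T : pseudoMetricType R}.
Variables (f : T -> T) (e : R).
Hypothesis e0 : 0 < e.
Implicit Types (J : set T) (n t : nat).

Lemma bowen_separatedU n (E E' : {fset T}) :
  bowen_separated f n e E -> bowen_separated f n e E' ->
  (forall x y, x \in E -> y \in E' ->
     exists2 i, (i < n)%N & ~ ball (iter i f x) e (iter i f y)) ->
  bowen_separated f n e (E `|` E')%fset /\ #|` (E `|` E')%fset| = (#|` E| + #|` E'|)%N.
Proof.
move=> sE sE' EE'; split.
  move=> x y; rewrite !inE => /orP[] xE /orP[] yE xy; first exact: sE; last exact: sE'.
  - exact: EE'.
  - have [i ni h] := EE' _ _ yE xE; exists i => // /ball_sym; exact: h.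
apply/eqP; rewrite (leq_card_fsetU E E').2.
apply/fdisjointP => x xE; apply/negP => xE'; have [i _] := EE' _ _ xE xE'.
by apply; exact: ballxx.
Qed.

(** Pulling back along an inverse branch [g] of [iter t f] delays every separation by [t] and loses
    no point. *)
Lemma bowen_separated_preimage J n t (g : T -> T) (E : {fset T}) :
  [set` E] `<=` J -> (forall x, J x -> iter t f (g x) = x) ->
  bowen_separated f n e E ->
  bowen_separated f (t + n) e (g @` E)%fset /\ #|` (g @` E)%fset| = #|` E|.
Proof.
move=> EJ fg sE; split; last first.
  apply/eqP/card_in_imfsetP => x y xE yE gxy.
  by rewrite -(fg x) ?gxy ?fg//; exact: EJ.
move=> _ _ /imfsetP[/= x xE ->] /imfsetP[/= y yE ->] gxy.
have xy : x != y by apply: contra gxy => /eqP ->.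
have [i ni h] := sE _ _ xE yE xy; exists (i + t)%N; first by lia_nat.
by rewrite !iterD !fg//; exact: EJ.
Qed.

(** Counterpart of [sep_bound_growth]: three pulled-back sets, told apart from each other by time
    [t1], are united, so their cardinalities add up. *)
Lemma separated_growth J t1 t2 t3 (g1 g2 g3 : T -> T) (y : R) :
  0 < y <= 1 -> 1 <= y ^+ t1 + y ^+ t2 + y ^+ t3 ->
  (0 < t1)%N -> (0 < t2)%N -> (0 < t3)%N -> J !=set0 ->
  (forall x, J x -> J (g1 x) /\ iter t1 f (g1 x) = x) ->
  (forall x, J x -> J (g2 x) /\ iter t2 f (g2 x) = x) ->
  (forall x, J x -> J (g3 x) /\ iter t3 f (g3 x) = x) ->
  (forall x x', J x -> J x' -> exists2 i, (i <= t1)%N &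
     ~ ball (iter i f (g1 x)) e (iter i f (g2 x'))) ->
  (forall x x', J x -> J x' -> exists2 i, (i <= t1)%N &
     ~ ball (iter i f (g1 x)) e (iter i f (g3 x'))) ->
  (forall x x', J x -> J x' -> exists2 i, (i <= t1)%N &
     ~ ball (iter i f (g2 x)) e (iter i f (g3 x'))) ->
  exists2 c, 0 < c & forall n, exists2 E : {fset T},
    [set` E] `<=` J /\ bowen_separated f n e E & c * y^-1 ^+ n <= (#|` E|)%:R.
Proof.
move=> /andP[y0 y1] yt t10 t20 t30 [x0 Jx0] G1 G2 G3 G12 G13 G23.
(* With this constant the required size is at most 1 for [n <= t], so a singleton starts the
   induction. *)
pose t := (t1 + t2 + t3)%N; exists (y ^+ t); first exact: exprn_gt0.
have yl n k : (k <= n)%N -> y^-1 ^+ (n - k) = y ^+ k * y^-1 ^+ n.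
  move=> kn; rewrite -[in RHS](subnK kn) exprD mulrCA -exprMn mulfV ?gt_eqF//.
  by rewrite expr1n mulr1.
elim/ltn_ind => n ih; have [nt|tn] := leqP n t.
  exists [fset x0]%fset.
    split; first by move=> x /=; rewrite inE => /eqP ->.
    by move=> x x'; rewrite !inE => /eqP -> /eqP ->; rewrite eqxx.
  rewrite cardfs1 -(subnK nt) exprD -mulrA -exprMn mulfV ?gt_eqF// expr1n mulr1.
  by rewrite exprn_ile1// ltW.
have [E1 [E1J s1] c1] := ih (n - t1)%N ltac:(rewrite /t in tn; lia_nat).
have [E2 [E2J s2] c2] := ih (n - t2)%N ltac:(rewrite /t in tn; lia_nat).
have [E3 [E3J s3] c3] := ih (n - t3)%N ltac:(rewrite /t in tn; lia_nat).
have := bowen_separated_preimage _ _ _ _ _ E1J (fun x Jx => (G1 x Jx).2) s1.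
have := bowen_separated_preimage _ _ _ _ _ E2J (fun x Jx => (G2 x Jx).2) s2.
have := bowen_separated_preimage _ _ _ _ _ E3J (fun x Jx => (G3 x Jx).2) s3.
rewrite !subnKC; [|rewrite /t in tn; lia_nat..].
move=> [{}s3 k3] [{}s2 k2] [{}s1 k1].
have [|s12 k12] := bowen_separatedU _ _ _ s1 s2.
  move=> _ _ /imfsetP[/= x xE ->] /imfsetP[/= x' xE' ->].
  have [i it1 h] := G12 _ _ (E1J _ xE) (E2J _ xE'); exists i => //.
  by rewrite /t in tn; lia_nat.
have [|s123 k123] := bowen_separatedU _ _ _ s12 s3.
  move=> x _ + /imfsetP[/= x' xE' ->]; rewrite inE => /orP[] /imfsetP[/= z zE ->].
    have [i it1 h] := G13 _ _ (E1J _ zE) (E3J _ xE'); exists i => //.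
    by rewrite /t in tn; lia_nat.
  have [i it1 h] := G23 _ _ (E2J _ zE) (E3J _ xE'); exists i => //.
  by rewrite /t in tn; lia_nat.
eexists; [split; [|exact: s123]|].
  move=> x /=; rewrite !inE => /orP[/orP[]|] /imfsetP[/= z zE ->].
  - exact: (G1 _ (E1J _ zE)).1.
  - exact: (G2 _ (E2J _ zE)).1.
  - exact: (G3 _ (E3J _ zE)).1.
rewrite k123 k12 k1 k2 k3 !natrD.
apply: le_trans (lerD (lerD c1 c2) c3); rewrite !yl; [|rewrite /t in tn; lia_nat..].
rewrite -!mulrDr -!mulrDl; apply: ler_wpM2l; first by rewrite exprn_ge0// ltW.
by rewrite ler_peMl// exprn_ge0// invr_ge0 ltW.
Qed.

End separated_growth.

(** * Arcs *)

Section chart.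
Context {R : realType}.
Implicit Types (p q : R -> R * R) (x y s t e m : R) (n : nat).

Definition arc p s t : set (R * R) := [set p x | x in `[s, t]].

(** The abscissa is isometric and the ordinate 1-Lipschitz, so [p] is isometric for the sup distance
    of [R * R]. *)
Definition chart p := forall x y,
  `|(p x).1 - (p y).1| = `|x - y| /\ `|(p x).2 - (p y).2| <= `|x - y|.

Lemma ball_pairE e (P Q : R * R) :
  ball P e Q <-> `|P.1 - Q.1| < e /\ `|P.2 - Q.2| < e.
Proof. by rewrite -[ball P e Q]/(prod_ball P e Q) /prod_ball -!ball_normE. Qed.

Lemma ball_chart p e x y : chart p -> ball (p x) e (p y) <-> `|x - y| < e.
Proof.
move=> cp; have [e1 e2] := cp x y; rewrite ball_pairE e1; split => [[]//|h].
by split => //; exact: le_lt_trans e2 h.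
Qed.

Lemma arcS p s t s' t' : s' <= s -> t <= t' -> arc p s t `<=` arc p s' t'.
Proof.
move=> ss tt P [x /=]; rewrite in_itv/= => /andP[sx xt] <-; exists x => //=.
by rewrite in_itv/=; apply/andP; split; lra.
Qed.

Lemma arc_split p r s t : arc p s t `<=` arc p s r `|` arc p r t.
Proof.
move=> P [x /=]; rewrite in_itv/= => /andP[sx xt] <-.
case: (lerP x r) => xr; [left|right]; exists x => //=; rewrite in_itv/=;
  by apply/andP; split; lra.
Qed.

Lemma sep_bound_mono (f : R * R -> R * R) (J : set (R * R)) e n n' m : (n <= n')%N ->
  sep_bound f J n' e m -> sep_bound f J n e m.
Proof.
move=> nn' sJ E EJ sE; apply: sJ => // x y xE yE xy.
by have [i ni h] := sE _ _ xE yE xy; exists i => //; exact: leq_trans nn'.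
Qed.

(** Pigeonhole: [h] numbers the cells of length [e] of the abscissa, and two points in one cell are
    closer than [e]. *)
Lemma sep_bound_arc1 (f : R * R -> R * R) p s t e : 0 < e -> chart p ->
  exists m, sep_bound f (arc p s t) 1 e m.
Proof.
move=> e0 cp; pose M := `|(p s).1| + `|t - s|.
pose h (P : R * R) := Num.truncn ((P.1 + M) / e).
pose N := (Num.truncn (2 * M / e)).+1; exists N%:R => E EJ sE; rewrite ler_nat.
have EM P : P \in E -> 0 <= P.1 + M <= 2 * M.
  move=> /EJ[x /=]; rewrite in_itv/= => /andP[sx xt] <-.
  have [+ _] := cp x s; rewrite /M.
  rewrite (@ger0_norm _ (x - s)) ?subr_ge0// (@ger0_norm _ (t - s)); last by lra.
  have := ler_norm ((p s).1); have := ler_norm (- (p s).1).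
  have := ler_norm ((p x).1 - (p s).1); have := ler_norm (- ((p x).1 - (p s).1)).
  by rewrite !normrN; lra.
have hinj : {in E &, injective h}.
  move=> P Q PE QE hPQ; apply/eqP/negPn/negP => PQ.
  have [[|//] _] := sE _ _ PE QE PQ; apply => /=.
  have [/andP[P0 _] /andP[Q0 _]] := (EM _ PE, EM _ QE).
  have : `|P.1 - Q.1| < e.
    have /andP[P1 P2] : (h P)%:R <= (P.1 + M) / e < (h P).+1%:R.
      by apply: truncn_itv; rewrite divr_ge0// ltW.
    have /andP[Q1 Q2] : (h P)%:R <= (Q.1 + M) / e < (h P).+1%:R.
      by rewrite hPQ; apply: truncn_itv; rewrite divr_ge0// ltW.
    move: P1 P2 Q1 Q2; rewrite !ler_pdivlMr// !ltr_pdivrMr// -natr1 mulrDl mul1r.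
    by move=> *; rewrite ltr_norml; apply/andP; split; lra.
  case: (EJ _ PE) (EJ _ QE) => x _ <- [y _ <-].
  by rewrite (cp x y).1 => xy; apply/ball_chart.
have -> : #|` E| = #|` (h @` E)%fset| by apply/esym/eqP/card_in_imfsetP.
rewrite -[N](size_iota 0) (leq_trans _ (size_undup _))// -card_fseq.
apply: fsubset_leq_card; apply/fsubsetP => _ /imfsetP[/= P PE ->].
have -> : (h P \in [fset x in iota 0 N]%fset) = (h P < N)%N.
  by rewrite in_fset; exact: mem_iota.
rewrite /N ltnS; apply: le_truncn.
by rewrite ler_pM2r ?invr_gt0//; have /andP[] := EM _ PE.
Qed.

End chart.

(** * The return map to P3P11 *)

Section dynamics.
Context {R : realType}.
Variables (b e : R).
Hypotheses (b4 : 4 < b) (b8 : b < 8).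
Hypothesis e0 : 0 < e.
Local Ltac lra_b := have := b4; have := b8; move=> ? ?; lra.
Implicit Types (p q : R -> R * R) (x u v s t m : R) (n k : nat) (J K : set (R * R)).

(* Abscissa parametrizations: [pA], [pB], [pC], [pD], [pE] of the segments P3P11,
   P3P5, P6P8, P8P10, P9P11; [pU] is [pA] read from right to left. *)
Definition pU u : R * R := (- u, - u + b + 1).
Definition pA x : R * R := (x, x + b + 1).
Definition pB x : R * R := (x, - 1).
Definition pC x : R * R := (x, b - 1 - x).
Definition pD x : R * R := (x, x + b - 1).
Definition pE x : R * R := (x, 2 * b - 1).

(** * The five charts and the action of [F] on them *)

Let affine_chart p (a c a' c' : R) :
  p = (fun x => (a * x + c, a' * x + c')) -> `|a| = 1 -> `|a'| <= 1 -> chart p.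
Proof.
move=> -> a1 a'1 x y /=.
have -> : a * x + c - (a * y + c) = a * (x - y) by ring.
have -> : a' * x + c' - (a' * y + c') = a' * (x - y) by ring.
by rewrite !normrM a1 mul1r; split => //; rewrite ler_piMl.
Qed.

Let cU : chart pU.
Proof.
apply: (@affine_chart _ (-1) 0 (-1) (b + 1)); rewrite ?normrN1//.
by apply/funext => u; rewrite /pU; congr pair; ring.
Qed.
Let cA : chart pA.
Proof.
apply: (@affine_chart _ 1 0 1 (b + 1)); rewrite ?normr1//.
by apply/funext => u; rewrite /pA; congr pair; ring.
Qed.
Let cB : chart pB.
Proof.
apply: (@affine_chart _ 1 0 0 (- 1)); rewrite ?normr1// ?normr0//.
by apply/funext => u; rewrite /pB; congr pair; ring.
Qed.
Let cC : chart pC.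
Proof.
apply: (@affine_chart _ 1 0 (-1) (b - 1)); rewrite ?normrN1// ?normr1//.
by apply/funext => u; rewrite /pC; congr pair; ring.
Qed.
Let cD : chart pD.
Proof.
apply: (@affine_chart _ 1 0 1 (b - 1)); rewrite ?normr1//.
by apply/funext => u; rewrite /pD; congr pair; ring.
Qed.
Let cE : chart pE.
Proof.
apply: (@affine_chart _ 1 0 0 (2 * b - 1)); rewrite ?normr1// ?normr0//.
by apply/funext => u; rewrite /pE; congr pair; ring.
Qed.

Lemma F_U_low u : 0 <= u <= b + 1 -> F b (pU u) = pB (2 * u - b - 2).
Proof.
by move=> ?; rewrite /F /pU /pB/= normrN !ger0_norm; [congr pair; ring|lra_b|lra_b].
Qed.

Lemma F_U_high u : b + 1 <= u -> F b (pU u) = pC (2 * u - b - 2).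
Proof.
move=> ?; rewrite /F /pU /pC/= normrN ger0_norm; last by lra_b.
by rewrite ler0_norm; [congr pair; ring|lra_b].
Qed.

Lemma F_A_pos x : 0 <= x -> F b (pA x) = pB (- b - 2).
Proof.
by move=> ?; rewrite /F /pA /pB/= !ger0_norm; [congr pair; ring|lra_b|lra_b].
Qed.

Lemma F_B_neg x : x <= 0 -> F b (pB x) = pC (- x).
Proof.
by move=> ?; rewrite /F /pB /pC/= normrN1 ler0_norm//; congr pair; ring.
Qed.

Lemma F_B_pos x : 0 <= x -> F b (pB x) = pD x.
Proof.
by move=> ?; rewrite /F /pB /pD/= normrN1 ger0_norm//; congr pair; ring.
Qed.

Lemma F_C_neg x : 0 <= x <= b / 2 -> F b (pC x) = pU (b - 2 * x).
Proof.
by move=> ?; rewrite /F /pC /pU/= !ger0_norm; [congr pair; ring|lra_b|lra_b].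
Qed.

Lemma F_C_pos x : b / 2 <= x <= b - 1 -> F b (pC x) = pA (2 * x - b).
Proof.
by move=> ?; rewrite /F /pC /pA/= !ger0_norm; [congr pair; ring|lra_b|lra_b].
Qed.

Lemma F_C_high x : b - 1 <= x -> F b (pC x) = pE (2 * x - b).
Proof.
move=> ?; rewrite /F /pC /pE/= ger0_norm; last by lra_b.
by rewrite ler0_norm; [congr pair; ring|lra_b].
Qed.

Lemma F_D x : 0 <= x -> F b (pD x) = pU b.
Proof.
by move=> ?; rewrite /F /pD /pU/= !ger0_norm; [congr pair; ring|lra_b|lra_b].
Qed.

Lemma F_E x : 0 <= x -> F b (pE x) = pU (2 * b - x).
Proof.
by move=> ?; rewrite /F /pE /pU/= !ger0_norm; [congr pair; ring|lra_b|lra_b].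
Qed.

(** Itinerary [pU], [pB], [pC], [pE], [pU]. At [u = 3 / 2] the point on [pC] has abscissa [b - 1],
    where its ordinate vanishes. *)
Lemma iter_F_I1 u : 0 <= u <= 3 / 2 -> iter 4 (F b) (pU u) = pU (b - 4 + 4 * u).
Proof.
move=> ?; rewrite /= F_U_low ?F_B_neg ?F_C_high ?F_E; last 4 first.
- lra_b.
- lra_b.
- lra_b.
- lra_b.
by congr pU; ring.
Qed.

(** Itinerary [pU], [pB], [pC], [pU]. The upper end keeps the point of [pB] at a nonpositive
    abscissa, the lower end keeps that of [pC] at most [b / 2]. *)
Lemma iter_F_I2 u : (b + 4) / 4 <= u <= (b + 2) / 2 ->
  iter 3 (F b) (pU u) = pU (4 * u - b - 4).
Proof.
move=> ?; rewrite /= F_U_low ?F_B_neg ?F_C_neg; last 3 first.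
- lra_b.
- lra_b.
- lra_b.
by congr pU; ring.
Qed.

(** Itinerary [pU], [pC], [pE], [pU]; beyond [b + 1] the ordinate of [pU u] is nonpositive. *)
Lemma iter_F_I3 u : b + 1 <= u <= b + 2 ->
  iter 3 (F b) (pU u) = pU (5 * b + 4 - 4 * u).
Proof.
move=> ?; rewrite /= F_U_high ?F_C_high ?F_E; last 3 first.
- lra_b.
- lra_b.
- lra_b.
by congr pU; ring.
Qed.

(** * Arcs that some iterate of [F] collapses *)

Let bound J n m := sep_bound (F b) J n e m.
Local Notation U := (arc pU).

(** Bounded uniformly in [n]: such pieces only enter the additive constants of the recursions. *)
Let tame J := exists C, forall n, bound J n C.

Lemma F_lipschitz (P Q : R * R) d : ball P d Q -> ball (F b P) (2 * d) (F b Q).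
Proof.
move=> /ball_pairE[h1 h2]; apply/ball_pairE; rewrite /F/=.
have k1 := ler_dist_dist P.1 Q.1; have k2 := ler_dist_dist P.2 Q.2.
split; apply: le_lt_trans (_ : _ <= `|P.1 - Q.1| + `|P.2 - Q.2|) _; try lra_b.
- have -> : `|P.1| - P.2 - 1 - (`|Q.1| - Q.2 - 1) = (`|P.1| - `|Q.1|) - (P.2 - Q.2).
    by ring.
  by rewrite (le_trans (ler_normB _ _))// lerD2r.
- have -> : P.1 - `|P.2| + b - (Q.1 - `|Q.2| + b) = (P.1 - Q.1) - (`|P.2| - `|Q.2|).
    by ring.
  by rewrite (le_trans (ler_normB _ _))// lerD2l.
Qed.

(** As [F] is 2-Lipschitz, points closer than [e / 2 ^+ n] stay [e]-close throughout the window,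
    which reduces to [n = 1] at a finer scale. It gives the finiteness asked by
    [sep_bound_growth]. *)
Lemma sep_bound_arc p s t n : chart p -> exists m, bound (arc p s t) n m.
Proof.
move=> cp; have d0 : 0 < e / 2 ^+ n by rewrite divr_gt0// exprn_gt0.
have [m mP] := sep_bound_arc1 (F b) p s t _ d0 cp; exists m => E EJ sE.
apply: mP => // x y xE yE xy; exists 0%N => //= h.
have [i ni] := sE _ _ xE yE xy; apply.
suff : ball (iter i (F b) x) (2 ^+ i * (e / 2 ^+ n)) (iter i (F b) y).
  apply: le_ball; rewrite mulrCA ger_pMr// ler_pdivrMr ?exprn_gt0// mul1r.
  by rewrite ler_weXn2l ?ler1n// ltnW.
elim: i {ni} => [|i ih]; first by rewrite mul1r.
by rewrite exprS -mulrA; exact: F_lipschitz.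
Qed.

Lemma bound_arc_step p q a d s t s' t' n m : (0 < n)%N -> chart p -> chart q ->
  1 <= `|a| -> (forall x, s <= x <= t -> F b (p x) = q (a * x + d)) ->
  (forall x, s <= x <= t -> s' <= a * x + d <= t') ->
  bound (arc q s' t') n m -> bound (arc p s t) n.+1 m.
Proof.
move=> n0 cp cq a1 Fp st'; apply: sep_bound_step => //.
  move=> _ [_ [x /= + <-] <-]; rewrite in_itv/= => xst; rewrite Fp//.
  by exists (a * x + d) => //=; rewrite in_itv/= st'.
move=> _ _ [x /= + <-] [y /= + <-]; rewrite !in_itv/= => xst yst.
rewrite !Fp// => /(ball_chart _ _ _ _ cq) h; apply/(ball_chart _ _ _ _ cp).
move: h; have -> : a * x + d - (a * y + d) = a * (x - y) by ring.
by rewrite normrM; apply: le_lt_trans; rewrite ler_peMl.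
Qed.

Let tame_step p q a d s t s' t' : chart p -> chart q ->
  1 <= `|a| -> (forall x, s <= x <= t -> F b (p x) = q (a * x + d)) ->
  (forall x, s <= x <= t -> s' <= a * x + d <= t') ->
  tame (arc q s' t') -> tame (arc p s t).
Proof.
move=> cp cq a1 Fp st' [C hC]; exists C => n.
apply: (@sep_bound_mono _ _ _ _ _ n.+2); first by lia_nat.
exact: bound_arc_step a1 Fp st' (hC n.+1).
Qed.

Let tame_flat p s t Q : chart p -> (forall x, s <= x <= t -> F b (p x) = Q) ->
  tame (arc p s t).
Proof.
move=> cp Fp; have [C hC] := sep_bound_arc p s t 1 cp; exists C => n.
apply: sep_bound_flat => // _ _ [x /= + <-] [y /= + <-].
by rewrite !in_itv/= => *; rewrite !Fp.
Qed.

Let tameD : tame (arc pD 0 b).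
Proof. by apply: (@tame_flat _ _ _ (pU b)) => // x ?; rewrite F_D//; lra_b. Qed.

Let tameB : tame (arc pB 0 b).
Proof.
apply: (@tame_step _ pD 1 0 _ _ 0 b) tameD => //.
- by rewrite normr1.
- by move=> x ?; rewrite F_B_pos; [congr pD; ring|lra_b].
- by move=> x ?; lra_b.
Qed.

Let tameA : tame (arc pA 0 (b - 2)).
Proof. by apply: (@tame_flat _ _ _ (pB (- b - 2))) => // x ?; rewrite F_A_pos//; lra_b. Qed.

Let tameC : tame (arc pC (b / 2) (b - 1)).
Proof.
apply: (@tame_step _ pA 2 (- b) _ _ 0 (b - 2)) tameA => //.
- by rewrite ger0_norm//; lra_b.
- by move=> x ?; rewrite F_C_pos; [congr pA; ring|lra_b].
- by move=> x ?; lra_b.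
Qed.

(** The gap between the first two branches goes through [pB] and the middle of [pC] to the right
    half of [pA], which [F] collapses to P3. *)
Lemma tame_U_low s t : 3 / 2 <= s -> t <= (b + 4) / 4 -> tame (U s t).
Proof.
move=> s1 t1; apply: (@tame_step _ pB 2 (- b - 2) _ _ (1 - b) (- (b / 2))) => //.
- by rewrite ger0_norm//; lra_b.
- by move=> u ?; rewrite F_U_low; [congr pB; ring|lra_b].
- by move=> u ?; lra_b.
apply: (@tame_step _ pC (-1) 0 _ _ (b / 2) (b - 1)) tameC => //.
- by rewrite normrN1.
- by move=> x ?; rewrite F_B_neg; [congr pC; ring|lra_b].
- by move=> x ?; lra_b.
Qed.

(** The gap between the last two branches goes through the right half of [pB] to [pD], which [F]
    collapses to [pU b]. *)
Lemma tame_U_high s t : (b + 2) / 2 <= s -> t <= b + 1 -> tame (U s t).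
Proof.
move=> s1 t1; apply: (@tame_step _ pB 2 (- b - 2) _ _ 0 b) tameB => //.
- by rewrite ger0_norm//; lra_b.
- by move=> u ?; rewrite F_U_low; [congr pB; ring|lra_b].
- by move=> u ?; lra_b.
Qed.

(** * Counting along the expanding branches *)

Lemma bound_I1 s t n m : (0 < n)%N -> 0 <= s -> t <= 3 / 2 ->
  bound (U (b - 4 + 4 * s) (b - 4 + 4 * t)) n m -> bound (U s t) (n + 4) m.
Proof.
move=> n0 s0 t1 h; rewrite addn4.
apply: (@bound_arc_step _ pB 2 (- b - 2) _ _ (2 * s - b - 2) (2 * t - b - 2)) => //.
- by rewrite ger0_norm//; lra_b.
- by move=> u ?; rewrite F_U_low; [congr pB; ring|lra_b].
- by move=> u ?; lra_b.
apply: (@bound_arc_step _ pC (-1) 0 _ _ (b + 2 - 2 * t) (b + 2 - 2 * s)) => //.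
- by rewrite normrN1.
- by move=> x ?; rewrite F_B_neg; [congr pC; ring|lra_b].
- by move=> x ?; lra_b.
apply: (@bound_arc_step _ pE 2 (- b) _ _ (b + 4 - 4 * t) (b + 4 - 4 * s)) => //.
- by rewrite ger0_norm//; lra_b.
- by move=> x ?; rewrite F_C_high; [congr pE; ring|lra_b].
- by move=> x ?; lra_b.
apply: (@bound_arc_step _ pU (-1) (2 * b) _ _ (b - 4 + 4 * s) (b - 4 + 4 * t)) => //.
- by rewrite normrN1.
- by move=> x ?; rewrite F_E; [congr pU; ring|lra_b].
- by move=> x ?; lra_b.
Qed.

Lemma bound_I2 s t n m : (0 < n)%N -> (b + 4) / 4 <= s -> t <= (b + 2) / 2 ->
  bound (U (4 * s - b - 4) (4 * t - b - 4)) n m -> bound (U s t) (n + 3) m.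
Proof.
move=> n0 s0 t1 h; rewrite addn3.
apply: (@bound_arc_step _ pB 2 (- b - 2) _ _ (2 * s - b - 2) (2 * t - b - 2)) => //.
- by rewrite ger0_norm//; lra_b.
- by move=> u ?; rewrite F_U_low; [congr pB; ring|lra_b].
- by move=> u ?; lra_b.
apply: (@bound_arc_step _ pC (-1) 0 _ _ (b + 2 - 2 * t) (b + 2 - 2 * s)) => //.
- by rewrite normrN1.
- by move=> x ?; rewrite F_B_neg; [congr pC; ring|lra_b].
- by move=> x ?; lra_b.
apply: (@bound_arc_step _ pU (-2) b _ _ (4 * s - b - 4) (4 * t - b - 4)) => //.
- by rewrite normrN ger0_norm//; lra_b.
- by move=> x ?; rewrite F_C_neg; [congr pU; ring|lra_b].
- by move=> x ?; lra_b.
Qed.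

Lemma bound_I3 n m : (0 < n)%N ->
  bound (U (b - 4) b) n m -> bound (U (b + 1) (b + 2)) (n + 3) m.
Proof.
move=> n0 h; rewrite addn3.
apply: (@bound_arc_step _ pC 2 (- b - 2) _ _ b (b + 2)) => //.
- by rewrite ger0_norm//; lra_b.
- by move=> u ?; rewrite F_U_high; [congr pC; ring|lra_b].
- by move=> u ?; lra_b.
apply: (@bound_arc_step _ pE 2 (- b) _ _ b (b + 4)) => //.
- by rewrite ger0_norm//; lra_b.
- by move=> x ?; rewrite F_C_high; [congr pE; ring|lra_b].
- by move=> x ?; lra_b.
apply: (@bound_arc_step _ pU (-1) (2 * b) _ _ (b - 4) b) => //.
- by rewrite normrN1.
- by move=> x ?; rewrite F_E; [congr pU; ring|lra_b].
- by move=> x ?; lra_b.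
Qed.


(* [b - 4] is the image of the endpoint [b + 2], and [orb k] its orbit under the
   expanding branch [u |-> 4 * u - b - 4], which fixes [(b + 4) / 3]. *)
Definition orb k : R := (b + 4 - 4 ^+ k * (16 - 2 * b)) / 3.

Let orb0 : orb 0 = b - 4. Proof. by rewrite /orb expr0; field. Qed.

Let orbS k : orb k.+1 = 4 * orb k - b - 4.
Proof. by rewrite /orb exprS; field. Qed.

(** Each return by the second branch stretches [U (orb k) ((b + 2) / 2)] to [U (orb k.+1) b]; what
    lies to the right of [(b + 2) / 2] is tame. *)
Lemma bound_K k : 0 <= orb k -> exists C, forall n m, (0 < n)%N ->
  bound (U (orb k) b) n m -> bound (U (b - 4) b) (n + 3 * k) (m + C).
Proof.
elim: k => [_|k ih ck].
  by exists 0 => n m n0; rewrite muln0 addn0 addr0 orb0.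
(* A nonnegative next value means that [orb k] was still in the domain of the second branch. *)
have ck' : (b + 4) / 4 <= orb k by move: ck; rewrite orbS; lra_b.
have [|C hC] := ih; first by lra_b.
have [C' hC'] := @tame_U_high ((b + 2) / 2) b ltac:(lra_b) ltac:(lra_b).
exists (C' + C) => n m n0 h; rewrite mulnS addnA addrA.
apply: hC; first by lia_nat.
apply: sep_boundU (hC' _); first exact: arc_split.
apply: bound_I2 => //.
by rewrite -orbS; have -> : 4 * ((b + 2) / 2) - b - 4 = b by field.
Qed.

(** * Exponential bounds, from the arc [U 0 b] to the whole graph *)

Let grows l J := exists A, forall n, bound J n (A * l ^+ n).

Let growsS l J K : J `<=` K -> grows l K -> grows l J.
Proof. by move=> JK [A hA]; exists A => n; apply: sep_boundS JK (hA n). Qed.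

Let growsU l J J1 J2 : J `<=` J1 `|` J2 -> grows l J1 -> grows l J2 -> grows l J.
Proof.
move=> JU [A hA] [A' hA']; exists (A + A') => n; rewrite mulrDl.
exact: sep_boundU JU (hA n) (hA' n).
Qed.

Let grows_split l p r s t : grows l (arc p s r) -> grows l (arc p r t) ->
  grows l (arc p s t).
Proof. by apply: growsU; exact: arc_split. Qed.

Let grows_tame l J : 1 <= l -> tame J -> grows l J.
Proof.
move=> l1 [C hC]; exists `|C| => n; apply: sep_bound_le (hC n).
by rewrite (le_trans (ler_norm _))// ler_peMr// exprn_ege1.
Qed.

Let grows_shift l J K k : 0 < l ->
  (forall n m, (0 < n)%N -> bound K n m -> bound J (n + k) m) ->
  grows l K -> grows l J.
Proof.
move=> l0 h [A hA]; exists (A * l) => n.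
apply: (@sep_bound_mono _ _ _ _ _ (n.+1 + k)); first by lia_nat.
by apply: h => //; rewrite -mulrA -exprS.
Qed.

Let grows_shift_tame l J K k : 1 <= l ->
  (exists C, forall n m, (0 < n)%N -> bound K n m -> bound J (n + k) (m + C)) ->
  grows l K -> grows l J.
Proof.
move=> l1 [C h] [A hA]; exists (A * l + `|C|) => n.
apply: (@sep_bound_mono _ _ _ _ _ (n.+1 + k)); first by lia_nat.
apply: sep_bound_le (h _ _ (ltn0Sn n) (hA n.+1)).
rewrite mulrDl -mulrA -exprS lerD2l (le_trans (ler_norm _))//.
by rewrite ler_peMr// exprn_ege1.
Qed.

Let grows_step l p q a d s t s' t' : 0 < l -> chart p -> chart q ->
  1 <= `|a| -> (forall x, s <= x <= t -> F b (p x) = q (a * x + d)) ->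
  (forall x, s <= x <= t -> s' <= a * x + d <= t') ->
  grows l (arc q s' t') -> grows l (arc p s t).
Proof.
move=> l0 cp cq a1 Fp st'; apply: (@grows_shift _ _ _ 1) => // n m n0 h.
by rewrite addn1; exact: bound_arc_step a1 Fp st' h.
Qed.

Lemma Gamma_arcs : Gamma b `<=` arc pA (- b - 2) (b - 2) `|`
  (arc pB (- b - 2) b `|` (arc pC 0 (b + 2) `|` (arc pD 0 b `|` arc pE (b - 2) (b + 4)))).
Proof.
move=> X [[[[]|]|]|] [t /=]; rewrite in_itv/= => /andP[t0 t1] <-.
all: have tb0 : 0 <= t * b by rewrite mulr_ge0//; lra_b.
all: have tbb : t * b <= b by rewrite ler_piMl//; lra_b.
- left; exists ((1 - t) * (- b - 2) + t * (b - 2)).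
    by rewrite /= in_itv/=; apply/andP; split; lra_b.
  by congr pair; ring.
- right; left; exists ((1 - t) * (- b - 2) + t * b).
    by rewrite /= in_itv/=; apply/andP; split; lra_b.
  by congr pair; ring.
- right; right; left; exists ((1 - t) * (b + 2) + t * 0).
    by rewrite /= in_itv/=; apply/andP; split; lra_b.
  by congr pair; ring.
- right; right; right; left; exists ((1 - t) * 0 + t * b).
    by rewrite /= in_itv/=; apply/andP; split; lra_b.
  by congr pair; ring.
- right; right; right; right; exists ((1 - t) * (b + 4) + t * (b - 2)).
    by rewrite /= in_itv/=; apply/andP; split; lra_b.
  by congr pair; ring.
Qed.

(** Every piece of the graph is either tame or carried without contraction, within a few steps, into
    an arc already treated: the order is [pU] up to [b + 2], [pE], [pC], then the rest. *)
Lemma grows_Gamma l : 1 <= l -> grows l (U 0 b) -> grows l (Gamma b).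
Proof.
move=> l1 hZ; have l0 : 0 < l by lra_b.
have hK : grows l (U (b - 4) b) by apply: growsS hZ; apply: arcS; lra_b.
have hU : grows l (U 0 (b + 2)).
  apply: (@grows_split _ _ b) => //; apply: (@grows_split _ _ (b + 1)).
    by apply: grows_tame => //; apply: tame_U_high; lra_b.
  by apply: grows_shift hK => // n m; exact: bound_I3.
have hE : grows l (arc pE (b - 2) (b + 4)).
  apply: (@grows_step _ _ pU (-1) (2 * b) _ _ 0 (b + 2)) hU => //.
  - by rewrite normrN1.
  - by move=> x ?; rewrite F_E; [congr pU; ring|lra_b].
  - by move=> x ?; lra_b.
have hC : grows l (arc pC 0 (b + 2)).
  apply: (@grows_split _ _ (b / 2)).
    apply: (@grows_step _ _ pU (-2) b _ _ 0 (b + 2)) hU => //.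
    - by rewrite normrN ger0_norm//; lra_b.
    - by move=> x ?; rewrite F_C_neg; [congr pU; ring|lra_b].
    - by move=> x ?; lra_b.
  apply: (@grows_split _ _ (b - 1)); first exact: grows_tame.
  apply: (@grows_step _ _ pE 2 (- b) _ _ (b - 2) (b + 4)) hE => //.
  - by rewrite ger0_norm//; lra_b.
  - by move=> x ?; rewrite F_C_high; [congr pE; ring|lra_b].
  - by move=> x ?; lra_b.
apply: (growsU _ _ _ _ Gamma_arcs).
  apply: (@grows_split _ _ 0); last exact: grows_tame.
  apply: growsS hU => _ [x /= + <-]; rewrite in_itv/= => /andP[x1 x2].
  exists (- x); last by rewrite /pU opprK.
  by rewrite /= in_itv/=; apply/andP; split; lra_b.
apply: (growsU _ _ _ _ (@subset_refl _ _)).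
  apply: (@grows_split _ _ 0); last exact: grows_tame.
  apply: (@grows_step _ _ pC (-1) 0 _ _ 0 (b + 2)) hC => //.
  - by rewrite normrN1.
  - by move=> x ?; rewrite F_B_neg; [congr pC; ring|lra_b].
  - by move=> x ?; lra_b.
apply: (growsU _ _ _ _ (@subset_refl _ _)) => //.
by apply: (growsU _ _ _ _ (@subset_refl _ _)) => //; exact: grows_tame.
Qed.

Let tame_shift J K k :
  (forall n m, (0 < n)%N -> bound K n m -> bound J (n + k) m) -> tame K -> tame J.
Proof.
move=> h [C hC]; exists C => n; apply: (@sep_bound_mono _ _ _ _ _ (n.+1 + k)).
  by lia_nat.
exact: h.
Qed.

(** * The three recursions for the upper bounds *)

Let bound_right : exists C, forall n m m', (3 < n)%N ->
  bound (U (5 / 4) (3 / 2)) n m -> bound (U 0 b) (n - 3) m' ->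
  bound (U (5 / 4) b) n (m + m' + C).
Proof.
have [C1 h1] := @tame_U_low (3 / 2) ((b + 4) / 4) ltac:(lra_b) ltac:(lra_b).
have [C2 h2] := @tame_U_high ((b + 2) / 2) b ltac:(lra_b) ltac:(lra_b).
exists (C1 + C2) => n m m' n3 hm hm'.
apply: (@sep_bound_le _ _ _ _ _ _ (m + (C1 + (m' + C2)))); first by lra_b.
apply: sep_boundU hm _; first exact: arc_split.
apply: sep_boundU (h1 n) _; first exact: arc_split.
apply: sep_boundU _ (h2 n); first exact: arc_split.
rewrite -(subnK (ltnW n3)); apply: bound_I2; [by lia_nat|lra_b|lra_b|].
have -> : 4 * ((b + 4) / 4) - b - 4 = 0 by field.
by have -> : 4 * ((b + 2) / 2) - b - 4 = b by field.
Qed.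

(** The first branch sends [(10 - b) / 8] and [5 / 4] to [(b + 2) / 2] and [b + 1], the ends of the
    upper gap. *)
Let tame_mid s : (10 - b) / 8 <= s -> tame (U s (5 / 4)).
Proof.
move=> hs; apply: (@tame_shift _ (U (b - 4 + 4 * s) (b - 4 + 4 * (5 / 4))) 4).
  by move=> n m n0; apply: bound_I1 => //; lra_b.
by apply: tame_U_high; lra_b.
Qed.

Let bound_I1_left n m : (0 < n)%N ->
  bound (U (b - 4) b) n m -> bound (U 0 1) (n + 4) m.
Proof.
move=> n0 h; apply: bound_I1 => //; first by lra_b.
have -> : b - 4 + 4 * 0 = b - 4 by ring.
by have -> : b - 4 + 4 * 1 = b by ring.
Qed.

Let bound_I1_right n m : (0 < n)%N ->
  bound (U (b - 4) b) n m -> bound (U (5 / 4) (3 / 2)) (n + 7) m.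
Proof.
move=> n0 h; rewrite (addnA n 3 4); apply: bound_I1; [by lia_nat|lra_b|lra_b|].
have -> : b - 4 + 4 * (5 / 4) = b + 1 by field.
have -> : b - 4 + 4 * (3 / 2) = b + 2 by field.
exact: bound_I3.
Qed.

(** The second branch covers [U 0 b] in 3 steps; [U 0 1] reaches [U (b - 4) b] in 4 steps and
    [U (5 / 4) (3 / 2)] in 7, after which [j] steps spread that arc over [U 0 b]. *)
Lemma grows_U_base j y : 0 < y <= 1 ->
  y ^+ 3 + y ^+ (j + 4) + y ^+ (j + 7) <= 1 ->
  (exists C, forall n m, (0 < n)%N ->
     bound (U 0 b) n m -> bound (U (b - 4) b) (n + j) (m + C)) ->
  grows y^-1 (U 0 b).
Proof.
move=> y01 hy [C hC].
have [C1 h1] := bound_right.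
have [C2 h2] := @tame_mid 1 ltac:(lra_b).
apply: (@sep_bound_growth _ _ _ _ _ 3 (j + 4) (j + 7) y (C + C2 + C + C1)) => //.
- by lia_nat.
- by lia_nat.
- by move=> n; apply: sep_bound_arc.
move=> n m1 m2 m3 nt hm1 hm2 hm3.
apply: (@sep_bound_le _ _ _ _ _ _ (m2 + C + (C2 + (m3 + C + m1 + C1)))); first by lra_b.
apply: sep_boundU (@arc_split _ _ 1 _ _) _ _.
  rewrite (_ : n = (n - (j + 4) + j + 4)%N); last by lia_nat.
  by apply: bound_I1_left; [lia_nat|apply: hC; [lia_nat|]].
apply: sep_boundU (@arc_split _ _ (5 / 4) _ _) (h2 n) _.
apply: h1 => //; first by lia_nat.
rewrite (_ : n = (n - (j + 7) + j + 7)%N); last by lia_nat.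
by apply: bound_I1_right; [lia_nat|apply: hC; [lia_nat|]].
Qed.

Lemma grows_S k y : 0 < y <= 1 -> 0 <= orb k ->
  y ^+ 3 + y ^+ (3 * k + 4) + y ^+ (3 * k + 7) <= 1 -> grows y^-1 (Gamma b).
Proof.
move=> y01 ck hy; apply: grows_Gamma; first by rewrite invf_ge1; case/andP: y01.
apply: grows_U_base y01 hy _; have [C hC] := bound_K k ck; exists C => n m n0 h.
by apply: hC => //; apply: sep_boundS h; apply: arcS; lra_b.
Qed.

(** As [orb k] is past the first branch, [U (orb k) b] meets, apart from tame gaps, only the second
    one; hence 3 more steps before [U 0 b] is covered, that is [j = 3 * k + 3]. *)
Lemma grows_V k y : 0 < y <= 1 -> 3 / 2 <= orb k ->
  y ^+ 3 + y ^+ (3 * k + 7) + y ^+ (3 * k + 10) <= 1 -> grows y^-1 (Gamma b).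
Proof.
move=> y01 ck hy; apply: grows_Gamma; first by rewrite invf_ge1; case/andP: y01.
apply: (@grows_U_base (3 * k + 3)) => //; first by rewrite -(addnA _ 3 4) -(addnA _ 3 7).
have [C hC] := bound_K k ltac:(lra_b).
have [C1 h1] := @tame_U_low (3 / 2) ((b + 4) / 4) ltac:(lra_b) ltac:(lra_b).
have [C2 h2] := @tame_U_high ((b + 2) / 2) b ltac:(lra_b) ltac:(lra_b).
exists (C + C1 + C2) => n m n0 h.
rewrite (addnC (3 * k)%N) addnA.
apply: (@sep_bound_le _ _ _ _ _ _ (C1 + (m + C2) + C)); first by lra_b.
apply: hC; first by lia_nat.
apply: (@sep_boundS _ _ _ _ _ (U (3 / 2) b)); first by apply: arcS; lra_b.
apply: sep_boundU (@arc_split _ _ ((b + 4) / 4) _ _) (h1 _) _.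
apply: sep_boundU (@arc_split _ _ ((b + 2) / 2) _ _) _ (h2 _).
apply: bound_I2 => //.
have -> : 4 * ((b + 4) / 4) - b - 4 = 0 by field.
by have -> : 4 * ((b + 2) / 2) - b - 4 = b by field.
Qed.

(** The recursion runs on [U t b], where [U t (5 / 4)] is tame. The second branch covers [U t b] in
    3 steps, and also [U 0 t], which needs 4 and then [3 * k] more steps; [U (5 / 4) (3 / 2)] needs
    7 and then [3 * k]. *)
Lemma grows_TU k y : 0 < y <= 1 -> (10 - b) / 8 <= orb k ->
  y ^+ 3 + y ^+ (3 * k + 7) + y ^+ (3 * k + 7) <= 1 -> grows y^-1 (Gamma b).
Proof.
move=> y01 ck hy.
have y0 : 0 < y^-1 by rewrite invr_gt0; case/andP: y01.
apply: grows_Gamma; first by rewrite invf_ge1; case/andP: y01.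
pose t := (10 - b) / 8.
have [C hC] : exists C, forall n m, (0 < n)%N ->
    bound (U t b) n m -> bound (U (b - 4) b) (n + 3 * k) (m + C).
  have [C hC] := bound_K k ltac:(lra_b); exists C => n m n0 h.
  by apply: hC => //; apply: sep_boundS h; apply: arcS; rewrite /t; lra_b.
have low n m : (0 < n)%N -> bound (U (b - 4) b) n m -> bound (U 0 t) (n + 4) m.
  move=> n0 h; apply: bound_I1; rewrite /t; [by []|lra_b|lra_b|].
  by apply: sep_boundS h; apply: arcS; lra_b.
have gY : grows y^-1 (U t b).
  have [C1 h1] := bound_right.
  have [C2 h2] := @tame_mid t ltac:(rewrite /t; lra_b).
  apply: (@sep_bound_growth _ _ _ _ _ 3 (3 * k + 7) (3 * k + 7) y (C + C2 + C + C1)) => //.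
  - by lia_nat.
  - by lia_nat.
  - by move=> n; apply: sep_bound_arc.
  move=> n m1 m2 m3 nt hm1 hm2 hm3.
  apply: (@sep_bound_le _ _ _ _ _ _ (C2 + (m3 + C + (m2 + C + m1) + C1))).
    by lra_b.
  apply: sep_boundU (@arc_split _ _ (5 / 4) _ _) (h2 n) _.
  apply: h1; first by lia_nat.
    rewrite (_ : n = (n - (3 * k + 7) + 3 * k + 7)%N); last by lia_nat.
    by apply: bound_I1_right; [lia_nat|apply: hC; [lia_nat|]].
  apply: sep_boundU (@arc_split _ _ t _ _) _ hm1.
  rewrite (_ : (n - 3 = n - (3 * k + 7) + 3 * k + 4)%N); last by lia_nat.
  by apply: low; [lia_nat|apply: hC; [lia_nat|]].
apply: (@grows_split _ _ t) => //; apply: (grows_shift _ _ _ _ y0 low).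
apply: (@grows_shift_tame _ _ (U t b) (3 * k)) gY; last by exists C.
by rewrite invf_ge1; case/andP: y01.
Qed.

(** * Lower bounds through inverse branches *)

Lemma iter_F_chain k v : 0 <= v <= b -> orb k <= v ->
  exists2 u, b - 4 <= u <= b & iter (3 * k) (F b) (pU u) = pU v.
Proof.
elim: k v => [|k ih] v v0b; first by rewrite orb0 => vb; exists v => //; lra_b.
(* Inverse of the second branch, which also pulls [orb k.+1 <= v] back to a bound by [orb k]. *)
rewrite orbS => cv; have [||u ub hu] := ih ((v + b + 4) / 4); [lra_b|lra_b|].
exists u => //; rewrite mulnS iterD hu iter_F_I2; last by lra_b.
by congr pU; field.
Qed.

Lemma Gamma_pU u : 0 <= u <= b -> Gamma b (pU u).
Proof.
move=> ?; do 4 left; exists ((b + 2 - u) / (2 * b)).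
  by rewrite /= in_itv/= divr_ge0 ?ler_pdivrMr//; lra_b.
by rewrite /= /pU; congr pair; field; apply/eqP; lra_b.
Qed.

Let ex_fun (J : set (R * R)) (Q : R * R -> R * R -> Prop) :
  (forall P, J P -> exists P', Q P P') -> exists g, forall P, J P -> Q P (g P).
Proof.
move=> h; have [P|g hg] := @choice _ _ (fun P P' => J P -> Q P P'); last by exists g.
by have [/h[P' ?]|?] := pselect (J P); [exists P'|exists P].
Qed.

Let not_ball u v : 1 / 4 <= `|u - v| -> ~ ball (pU u) (1 / 4) (pU v).
Proof. by move=> uv /(ball_chart _ _ _ _ cU); rewrite ltNge uv. Qed.

(** Itinerary marks that tell the inverse branches apart: target intervals at least [1 / 4] apart
    give separation at scale [1 / 4]. *)
Let hits n s t (P : R * R) := exists2 w, s <= w <= t & iter n (F b) P = pU w.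

Let hits_not_ball n s t s' t' P P' : t + 1 / 4 <= s' -> hits n s t P ->
  hits n s' t' P' -> ~ ball (iter n (F b) P) (1 / 4) (iter n (F b) P').
Proof.
move=> ts [w ws ->] [w' ws' ->]; apply: not_ball.
by rewrite ler0_norm; lra_b.
Qed.

Let hits_not_ballC n s t s' t' P P' : t + 1 / 4 <= s' -> hits n s' t' P ->
  hits n s t P' -> ~ ball (iter n (F b) P) (1 / 4) (iter n (F b) P').
Proof. by move=> ts h h' /ball_sym; exact: hits_not_ball ts h' h. Qed.

Let arcUP s t (P : R * R) : U s t P <-> exists2 u, s <= u <= t & P = pU u.
Proof.
by split => [[u /=]|[u]]; rewrite ?in_itv/= => su; exists u => //=; rewrite in_itv.
Qed.

(** Horseshoe criterion: [U s b] is covered along three branches whose marks differ within 3 steps;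
    [2 < t1] makes these times admissible in [separated_growth]. *)
Let entropy_ge s (t1 t2 t3 : nat) y (Q1 Q2 Q3 : set (R * R)) : 0 < y <= 1 ->
  1 <= y ^+ t1 + y ^+ t2 + y ^+ t3 -> 0 <= s <= b ->
  (2 < t1)%N -> (0 < t2)%N -> (0 < t3)%N ->
  (forall v, s <= v <= b ->
    exists2 u, s <= u <= b & iter t1 (F b) (pU u) = pU v /\ Q1 (pU u)) ->
  (forall v, s <= v <= b ->
    exists2 u, s <= u <= b & iter t2 (F b) (pU u) = pU v /\ Q2 (pU u)) ->
  (forall v, s <= v <= b ->
    exists2 u, s <= u <= b & iter t3 (F b) (pU u) = pU v /\ Q3 (pU u)) ->
  (forall P P', Q1 P -> Q2 P' -> exists2 i, (i <= 3)%N &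
     ~ ball (iter i (F b) P) (1 / 4) (iter i (F b) P')) ->
  (forall P P', Q1 P -> Q3 P' -> exists2 i, (i <= 3)%N &
     ~ ball (iter i (F b) P) (1 / 4) (iter i (F b) P')) ->
  (forall P P', Q2 P -> Q3 P' -> exists2 i, (i <= 3)%N &
     ~ ball (iter i (F b) P) (1 / 4) (iter i (F b) P')) ->
  ((ln y^-1)%:E <= h_F b)%E.
Proof.
move=> y01 hy sb t10 t20 t30.
have G (t : nat) (Q : set (R * R)) : (forall v, s <= v <= b ->
      exists2 u, s <= u <= b & iter t (F b) (pU u) = pU v /\ Q (pU u)) ->
    exists g, forall P, U s b P -> (U s b (g P) /\ iter t (F b) (g P) = P) /\ Q (g P).
  move=> h.
  apply: (ex_fun (U s b) (fun P P' => (U s b P' /\ iter t (F b) P' = P) /\ Q P')).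
  move=> P /arcUP[v sv ->]; have [u su [hu Qu]] := h v sv.
  by exists (pU u); split=> //; split => //; apply/arcUP; exists u.
move=> /G[g1 G1] /G[g2 G2] /G[g3 G3] Q12 Q13 Q23.
have q0 : 0 < 1 / 4 :> R by lra_b.
rewrite /h_F; apply: (@topological_entropy_ge _ _ _ _ _ (1 / 4)) => //; first by rewrite invr_gt0; case/andP: y01.
have [||||||||||c c0 H] := separated_growth (F b) (1 / 4) q0 (U s b) t1 t2 t3 g1 g2 g3 y y01 hy.
- by lia_nat.
- by [].
- by [].
- by exists (pU s); apply/arcUP; exists s => //; lra_b.
- by move=> x /G1[].
- by move=> x /G2[].
- by move=> x /G3[].
- move=> x x' /G1[_ q] /G2[_ q']; have [i i3 h] := Q12 _ _ q q'; exists i => //.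
  exact: leq_trans i3 t10.
- move=> x x' /G1[_ q] /G3[_ q']; have [i i3 h] := Q13 _ _ q q'; exists i => //.
  exact: leq_trans i3 t10.
- move=> x x' /G2[_ q] /G3[_ q']; have [i i3 h] := Q23 _ _ q q'; exists i => //.
  exact: leq_trans i3 t10.
exists c => // n; have [E [EU sE] cardE] := H n; exists E => //; split => //.
by move=> x /EU /arcUP[u su ->]; apply: Gamma_pU; lra_b.
Qed.

Let iter_I2_I1_K k v w : w = (v - b + 4) / 4 -> 0 <= w <= 1 ->
  iter (3 * k) (F b) (pU v) = iter (3 * k + 4) (F b) (pU w).
Proof.
move=> -> ?; rewrite iterD iter_F_I1; last by lra_b.
by congr (iter _ _ (pU _)); field.
Qed.

(** On [U ((b + 4) / 4) b] all three branches start with the second return branch, so they are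
    compared at time 3. Then the orbit is back, or makes a first-branch return, or a first- and a
    third-branch return, the last two followed by the [3 * k] steps of [iter_F_chain]. *)
Lemma entropy_ge_phi k y : 0 < y <= 1 -> orb k <= (b + 4) / 4 ->
  1 <= y ^+ 3 + y ^+ (3 * k + 7) + y ^+ (3 * k + 10) -> ((ln y^-1)%:E <= h_F b)%E.
Proof.
move=> y01 ck hy.
apply: (@entropy_ge ((b + 4) / 4) 3 (3 * k + 7) (3 * k + 10) y
  (hits 3 ((b + 4) / 4) b) (hits 3 0 1) (hits 3 (5 / 4) (3 / 2))) => //; try lia_nat; try lra_b.
- move=> v vb; exists ((v + b + 4) / 4); first by lra_b.
  have E : iter 3 (F b) (pU ((v + b + 4) / 4)) = pU v.
    by rewrite iter_F_I2; [congr pU; field|lra_b].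
  by split => //; exists v.
- move=> v vb; have [||u ub hu] := iter_F_chain k v; [lra_b|lra_b|].
  pose w := (u - b + 4) / 4; have wb : 0 <= w <= 1 by rewrite /w; lra_b.
  exists ((w + b + 4) / 4); first by lra_b.
  have E : iter 3 (F b) (pU ((w + b + 4) / 4)) = pU w.
    by rewrite iter_F_I2; [congr pU; field|lra_b].
  split; last by exists w.
  rewrite (_ : (3 * k + 7 = 3 * k + 4 + 3)%N); last by lia_nat.
  by rewrite iterD E -hu; apply/esym/iter_I2_I1_K.
- move=> v vb; have [||u ub hu] := iter_F_chain k v; [lra_b|lra_b|].
  (* The path is built backwards: [u'] is the preimage of [u] under the third branch, then [w] that
     of [u'] under the first. *)
  pose u' := (5 * b + 4 - u) / 4; have u'b : b + 1 <= u' <= b + 2 by rewrite /u'; lra_b.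
  pose w := (u' - b + 4) / 4; have wb : 5 / 4 <= w <= 3 / 2 by rewrite /w; lra_b.
  exists ((w + b + 4) / 4); first by lra_b.
  have E : iter 3 (F b) (pU ((w + b + 4) / 4)) = pU w.
    by rewrite iter_F_I2; [congr pU; field|lra_b].
  split; last by exists w.
  rewrite (_ : (3 * k + 10 = 3 * k + 3 + 4 + 3)%N); last by lia_nat.
  rewrite iterD E iterD iter_F_I1; last by lra_b.
  rewrite iterD (_ : b - 4 + 4 * w = u'); last by rewrite /w; field.
  by rewrite iter_F_I3// -hu; congr (iter _ _ (pU _)); rewrite /u'; field.
- move=> x x' hx hx'; exists 3 => //; apply: hits_not_ballC hx hx'; lra_b.
- move=> x x' hx hx'; exists 3 => //; apply: hits_not_ballC hx hx'; lra_b.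
- move=> x x' hx hx'; exists 3 => //; apply: hits_not_ball hx hx'; lra_b.
Qed.

(** The larger arc [U (5 / 4) b] contains [U (5 / 4) (3 / 2)], so the third branch saves its initial
    3 steps and is recognized at time 0. *)
Lemma entropy_ge_delta k y : 0 < y <= 1 -> orb k <= 5 / 4 ->
  1 <= y ^+ 3 + y ^+ (3 * k + 7) + y ^+ (3 * k + 7) -> ((ln y^-1)%:E <= h_F b)%E.
Proof.
move=> y01 ck hy.
apply: (@entropy_ge (5 / 4) 3 (3 * k + 7) (3 * k + 7) y
  (hits 3 (5 / 4) b `&` hits 0 ((b + 4) / 4) b) (hits 3 0 1 `&` hits 0 ((b + 4) / 4) b)
  (hits 0 (5 / 4) (3 / 2))) => //; try lia_nat; try lra_b.
- move=> v vb; exists ((v + b + 4) / 4); first by lra_b.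
  have E : iter 3 (F b) (pU ((v + b + 4) / 4)) = pU v.
    by rewrite iter_F_I2; [congr pU; field|lra_b].
  by split => //; split; [exists v|exists ((v + b + 4) / 4) => //; lra_b].
- move=> v vb; have [||u ub hu] := iter_F_chain k v; [lra_b|lra_b|].
  pose w := (u - b + 4) / 4; have wb : 0 <= w <= 1 by rewrite /w; lra_b.
  exists ((w + b + 4) / 4); first by lra_b.
  have E : iter 3 (F b) (pU ((w + b + 4) / 4)) = pU w.
    by rewrite iter_F_I2; [congr pU; field|lra_b].
  split; last by split; [exists w|exists ((w + b + 4) / 4) => //; lra_b].
  rewrite (_ : (3 * k + 7 = 3 * k + 4 + 3)%N); last by lia_nat.
  by rewrite iterD E -hu; apply/esym/iter_I2_I1_K.
- move=> v vb; have [||u ub hu] := iter_F_chain k v; [lra_b|lra_b|].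
  pose u' := (5 * b + 4 - u) / 4; have u'b : b + 1 <= u' <= b + 2 by rewrite /u'; lra_b.
  pose w := (u' - b + 4) / 4; have wb : 5 / 4 <= w <= 3 / 2 by rewrite /w; lra_b.
  exists w; first by lra_b.
  split; last by exists w.
  rewrite (_ : (3 * k + 7 = 3 * k + 3 + 4)%N); last by lia_nat.
  rewrite iterD iter_F_I1; last by lra_b.
  rewrite iterD (_ : b - 4 + 4 * w = u'); last by rewrite /w; field.
  by rewrite iter_F_I3// -hu; congr (iter _ _ (pU _)); rewrite /u'; field.
- move=> x x' [hx _] [hx' _]; exists 3 => //; apply: hits_not_ballC hx hx'; lra_b.
- move=> x x' [_ hx] hx'; exists 0%N => //; apply: hits_not_ballC hx hx'; lra_b.
- move=> x x' [_ hx] hx'; exists 0%N => //; apply: hits_not_ballC hx hx'; lra_b.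
Qed.

End dynamics.

(** * Upper bounds for the entropy on the graph *)

Section entropy_bounds.
Context {R : realType}.
Implicit Types (b y : R) (k : nat).

Let entropy_le b y : 0 < y ->
  (forall e, 0 < e -> exists A, forall n, sep_bound (F b) (Gamma b) n e (A * y^-1 ^+ n)) ->
  (h_F b <= (ln y^-1)%:E)%E.
Proof. by move=> y0; apply: topological_entropy_le; rewrite invr_gt0. Qed.

Lemma entropy_le_S b k y : 4 < b -> b < 8 -> 0 < y <= 1 -> 0 <= orb b k ->
  y ^+ 3 + y ^+ (3 * k + 4) + y ^+ (3 * k + 7) <= 1 -> (h_F b <= (ln y^-1)%:E)%E.
Proof.
move=> b4 b8 y01 ck hy; apply: entropy_le; first by case/andP: y01.
by move=> e e0; exact: (grows_S b e b4 b8 e0 k y).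
Qed.

Lemma entropy_le_delta b k y : 4 < b -> b < 8 -> 0 < y <= 1 -> (10 - b) / 8 <= orb b k ->
  y ^+ 3 + y ^+ (3 * k + 7) + y ^+ (3 * k + 7) <= 1 -> (h_F b <= (ln y^-1)%:E)%E.
Proof.
move=> b4 b8 y01 ck hy; apply: entropy_le; first by case/andP: y01.
by move=> e e0; exact: (grows_TU b e b4 b8 e0 k y).
Qed.

Lemma entropy_le_phi b k y : 4 < b -> b < 8 -> 0 < y <= 1 -> 3 / 2 <= orb b k ->
  y ^+ 3 + y ^+ (3 * k + 7) + y ^+ (3 * k + 10) <= 1 -> (h_F b <= (ln y^-1)%:E)%E.
Proof.
move=> b4 b8 y01 ck hy; apply: entropy_le; first by case/andP: y01.
by move=> e e0; exact: (grows_V b e b4 b8 e0 k y).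
Qed.

End entropy_bounds.

(** * The roots *)

Section char_roots.
Context {R : realType}.
Variables c0 c1 c2 : R.
Hypotheses (c0_ge0 : 0 <= c0) (c1_gt0 : 0 < c1) (c2_ge0 : 0 <= c2).
Implicit Types (n : nat) (x y : R).

(* With [y = 1 / x], the equation [charfun n y = 1] is the common form of the five
   equations for [alpha n], ..., [phi n] *)
Definition charfun n y := y ^+ 3 + y ^+ (3 * n + 4) * (c0 + c1 * y ^+ 3 + c2 * y ^+ 6).

Lemma charfun_lt n x y : 0 <= x -> x < y -> charfun n x < charfun n y.
Proof.
move: (c0_ge0) (c1_gt0) (c2_ge0) => h0 h1 h2 x0 xy.
have y0 : 0 <= y by lra.
have xyX i : x ^+ i <= y ^+ i by rewrite lerXn2r// ltW.
rewrite /charfun ltr_leD ?ltrXn2r//.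
rewrite ler_pM ?exprn_ge0 ?addr_ge0 ?mulr_ge0 ?exprn_ge0 ?(ltW h1)//.
by rewrite !lerD// ler_wpM2l// ltW.
Qed.

Lemma charfun_inj n x y : 0 <= x -> 0 <= y -> charfun n x = charfun n y -> x = y.
Proof.
move=> x0 y0 xy; have [h|h|//] := ltgtP x y.
- by have := charfun_lt n _ _ x0 h; rewrite xy ltxx.
- by have := charfun_lt n _ _ y0 h; rewrite xy ltxx.
Qed.

Lemma charfun_root_ex n : exists y, 0 < y < 1 /\ charfun n y = 1.
Proof.
move: (c0_ge0) (c1_gt0) (c2_ge0) => h0 h1 h2.
pose p : {poly R} := 'X^3 + 'X^(3 * n + 4) * (c0%:P + c1 *: 'X^3 + c2 *: 'X^6) - 1.
have pE y : p.[y] = charfun n y - 1 by rewrite /p /charfun !hornerE.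
have f0 : charfun n 0 = 0 by rewrite /charfun !expr0n addn4/= mul0r addr0.
have f1 : charfun n 1 = 1 + (c0 + c1 + c2) by rewrite /charfun !expr1n !mulr1 mul1r.
have [|y y01 /rootP] := @poly_ivt _ p 0 1 ler01.
  by rewrite !pE f0 f1; apply/andP; split; lra.
rewrite pE => /eqP; rewrite subr_eq0 => /eqP y1; exists y; split => //.
case/andP: y01 => y0 yle1; rewrite !lt_neqAle y0 yle1 !andbT.
apply/andP; split; apply/eqP => yE; move: y1.
  by rewrite -yE f0; lra.
by rewrite yE f1; lra.
Qed.

(** [charfun n] increases with its argument and, at points of (0, 1), decreases with [n]; so the
    roots move to the right. *)
Lemma charfun_roots : exists y : nat -> R,
  [/\ forall n, 0 < y n < 1 /\ charfun n (y n) = 1,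
      forall n, y n < y n.+1 & y n @[n --> \oo] --> (1 : R)].
Proof.
move: (c0_ge0) (c1_gt0) (c2_ge0) => h0 h1 h2.
have [y yP] := choice charfun_root_ex; exists y; split=> //.
  move=> n; have [/andP[y0 y1] yn] := yP n; have [/andP[y0' _] yn'] := yP n.+1.
  rewrite ltNge; apply/negP => yle.
  have : charfun n (y n) > charfun n.+1 (y n).
    rewrite /charfun ltrD2l ltr_pM2r; last first.
      apply: ltr_wpDr; first by rewrite mulr_ge0// exprn_ge0// ltW.
      by apply: ltr_wpDl => //; rewrite mulr_gt0// exprn_gt0.
    by rewrite ltr_iXn2l//; lia_nat.
  rewrite yn -yn' ltNge => /negP; apply.
  by move: yle; rewrite le_eqVlt => /predU1P[->//|/(charfun_lt n.+1 _ _ (ltW y0'))/ltW].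
(* For a fixed [t] in (0, 1), [charfun n t <= t ^+ 3 + t ^+ n * S], which is below 1 for large [n];
   the root then exceeds [t]. *)
apply/cvgrPdist_lt => e e0; pose t := Num.max (1 - e) (1 / 2).
have t0 : 0 < t by rewrite lt_max; apply/orP; right; lra.
have t1 : t < 1 by rewrite gt_max; apply/andP; split; lra.
have te : 1 - e <= t by rewrite le_max lexx.
pose S := c0 + c1 + c2; have S0 : 0 < S by rewrite /S; lra.
have t3 : 0 < (1 - t ^+ 3) / S by rewrite divr_gt0// subr_gt0 exprn_ilt1// ltW.
have /cvgrPdist_lt/(_ _ t3) : (t ^+ n) @[n --> \oo] --> (0 : R).
  by apply: cvg_expr; rewrite ger0_norm// ltW.
apply: filterS => n; rewrite sub0r normrN ger0_norm ?exprn_ge0 ?ltW// ltr_pdivlMr// => tn.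
have [/andP[y0 y1] yn] := yP n.
rewrite ger0_norm; last by rewrite subr_ge0 ltW.
suff : t < y n by lra.
rewrite ltNge; apply/negP => ynt.
suff : charfun n (y n) < 1 by rewrite yn ltxx.
apply: (@le_lt_trans _ _ (charfun n t)).
  by move: ynt; rewrite le_eqVlt => /predU1P[->//|/(charfun_lt n _ _ (ltW y0))/ltW].
apply: (@le_lt_trans _ _ (t ^+ 3 + t ^+ n * S)); last by lra.
have tX i : t ^+ i <= 1 by rewrite exprn_ile1// ltW.
rewrite /charfun lerD2l ler_pM ?exprn_ge0 ?addr_ge0 ?mulr_ge0 ?exprn_ge0 ?(ltW t0) ?(ltW h1)//.
  by rewrite ler_wiXn2l ?ltW//; lia_nat.
by rewrite /S !lerD// ler_piMr// ltW.
Qed.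

Lemma charfun_unique_positive_root n (p : {poly R}) y :
  0 < y < 1 -> charfun n y = 1 ->
  (forall x, 0 < x -> exists2 d, d != 0 & p.[x] = d * (1 - charfun n x^-1)) ->
  unique_positive_root p y^-1.
Proof.
move=> /andP[y0 y1] yn px; split; first by rewrite invr_gt0.
  have [d _ pE] := px y^-1 ltac:(by rewrite invr_gt0).
  by rewrite /root pE invrK yn subrr mulr0 eqxx.
move=> x x0 /rootP; have [d d0 ->] := px x x0.
move=> /eqP; rewrite mulf_eq0 (negbTE d0)/= subr_eq0 eq_sym -yn => /eqP.
by move=> /charfun_inj h; rewrite -[x]invrK h// ltW// invr_gt0.
Qed.

End char_roots.

(** * The parameter intervals *)

Section parameter_intervals.
Context {R : realType}.
Implicit Types (b : R) (n : nat) (k : 'I_4).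

Let pow4_ge1 n : 1 <= 4 ^+ n :> R. Proof. by rewrite exprn_ege1// ler1n. Qed.

(** The convention [4] for the first index agrees with the general formula. *)
Let p_predE n : p_pred R n = 4 * (4 * 4 ^+ n - 1) / (2 * 4 ^+ n + 1).
Proof. by case: n => [|n] //; rewrite /= expr0; field. Qed.

(** This and the next four equivalences give the dynamical meaning of the endpoints: they are the
    parameters at which the n-th return [orb b n] crosses [0], [(b + 4) / 4], [3 / 2], [5 / 4] or
    [(10 - b) / 8]. *)
Lemma p_pred_lt n b : (p_pred R n < b) = (0 < orb b n).
Proof.
have := pow4_ge1 n; rewrite p_predE /orb; set t := 4 ^+ n => t1.
by rewrite ltr_pdivrMr; [rewrite ltr_pdivlMr// mul0r; apply/idP/idP; lra|lra].
Qed.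

Lemma le_p n b : (b <= p_ R n) = (orb b n <= (b + 4) / 4).
Proof.
have := pow4_ge1 n; rewrite /p_ /orb exprS; set t := 4 ^+ n => t1.
by rewrite ler_pdivlMr; [rewrite ler_pdivrMr//; apply/idP/idP; lra|lra].
Qed.

Lemma q_le n b : (q_ R n <= b) = (3 / 2 <= orb b n).
Proof.
have := pow4_ge1 n; rewrite /q_ /orb exprS; set t := 4 ^+ n => t1.
by rewrite ler_pdivrMr; [rewrite ler_pdivlMr//; apply/idP/idP; lra|lra].
Qed.

Lemma le_r n b : (b <= r_ R n) = (orb b n <= 5 / 4).
Proof.
have := pow4_ge1 n; rewrite /r_ /orb exprS; set t := 4 ^+ n => t1.
by rewrite ler_pdivlMr; [rewrite ler_pdivrMr//; apply/idP/idP; lra|lra].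
Qed.

Lemma s_le n b : (s_ R n <= b) = ((10 - b) / 8 <= orb b n).
Proof.
have := pow4_ge1 n; rewrite /s_ /orb !exprS; set t := 4 ^+ n => t1.
by rewrite ler_pdivrMr; [rewrite ler_pdivlMr//; apply/idP/idP; lra|lra].
Qed.

Lemma parameters_lt n : 4 <= p_pred R n /\
  [/\ p_pred R n < s_ R n, s_ R n < r_ R n, r_ R n < q_ R n, q_ R n < p_ R n
    & p_ R n < 8].
Proof.
have := pow4_ge1 n; rewrite p_predE /s_ /r_ /q_ /p_ !exprS; set t := 4 ^+ n => t1.
split; first by rewrite ler_pdivlMr; lra.
split; last by rewrite ltr_pdivrMr; lra.
all: rewrite ltr_pdivrMr; last by lra.
all: rewrite mulrAC ltr_pdivlMr; last by lra.
all: nra.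
Qed.

Lemma p_pred_le m n : (m <= n)%N -> p_pred R m <= p_pred R n.
Proof.
elim: n => [|n ih]; first by rewrite leqn0 => /eqP ->.
rewrite leq_eqVlt => /predU1P[->//|/ih/le_trans]; apply.
by have [_ [? ? ? ? ?]] := parameters_lt n; rewrite -[p_pred R n.+1]/(p_ R n); lra.
Qed.

Lemma p_pred_cover b : 4 < b < 8 -> exists n, p_pred R n < b <= p_ R n.
Proof.
move=> /andP[b4 b8].
have ex : exists n, b <= p_ R n.
  have d0 : 0 <= (b + 4) / (8 - b) by rewrite divr_ge0//; lra.
  (* For this [n], [4 ^+ n * (8 - b)] exceeds [b + 4], which makes [orb b n] negative. *)
  exists (Num.Def.archi_bound ((b + 4) / (8 - b))).
  have := archi_boundP d0; set n := Num.Def.archi_bound _ => hn.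
  have n4 : n%:R <= 4 ^+ n :> R by rewrite -natrX ler_nat ltnW// ltn_expl.
  rewrite le_p /orb; move: hn; rewrite ltr_pdivrMr; last by lra.
  have : n%:R * (8 - b) <= 4 ^+ n * (8 - b) by rewrite ler_wpM2r//; lra.
  by move=> *; rewrite ler_pdivrMr//; lra.
have [n bn nmin] := ex_minnP ex; exists n; rewrite bn andbT.
case: n bn nmin => [//|n] _ nmin; rewrite -[p_pred R n.+1]/(p_ R n).
by rewrite ltNge; apply/negP => /nmin; rewrite ltnn.
Qed.

Lemma STUV_bounds n k b : STUV (n, k) b -> p_pred R n < b <= p_ R n /\ 4 < b < 8.
Proof.
have [h4 [? ? ? ? ?]] := parameters_lt n.
suff : STUV (n, k) b -> p_pred R n < b <= p_ R n.
  by move=> h /h /andP[? ?]; split; apply/andP; split; lra.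
case: k => [[|[|[|[|//]]]] ?]; rewrite /STUV/= /S_ /T_ /U_ /V_ /= in_itv/= => /andP[? ?];
  by apply/andP; split; lra.
Qed.

Lemma STUV_partition : partition [set: nat * 'I_4] (@STUV R) (`]4, 8[%classic).
Proof.
split.
- apply/seteqP; split=> [b [[n k] _ /STUV_bounds[_]]|b]; rewrite /= in_itv//=.
  move=> /p_pred_cover[n /andP[pb bp]].
  have [bs|sb] := ltrP b (s_ R n).
    by exists (n, inord 0) => //; rewrite /STUV/= inordK//= /S_ /= in_itv/= pb bs.
  have [br|rb] := lerP b (r_ R n).
    by exists (n, inord 1) => //; rewrite /STUV/= inordK//= /T_ /= in_itv/= sb br.
  have [bq|qb] := ltrP b (q_ R n).
    by exists (n, inord 2) => //; rewrite /STUV/= inordK//= /U_ /= in_itv/= rb bq.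
  by exists (n, inord 3) => //; rewrite /STUV/= inordK//= /V_ /= in_itv/= qb bp.
- move=> [n k] [n' k'] _ _ [b [h h']].
  have [/andP[h1 h2] _] := STUV_bounds _ _ _ h.
  have [/andP[h1' h2'] _] := STUV_bounds _ _ _ h'.
  have nn : n = n'.
    have [lt|lt|//] := ltngtP n n'.
      by exfalso; have : p_ R n <= p_pred R n' := p_pred_le _ _ lt; move=> {lt}; lra.
    by exfalso; have : p_ R n' <= p_pred R n := p_pred_le _ _ lt; move=> {lt}; lra.
  subst n'; congr pair; apply/val_inj => {h1 h2 h1' h2'}.
  have [_ [? ? ? ? ?]] := parameters_lt n.
  case: k k' h h' => [[|[|[|[|//]]]] ?] [[|[|[|[|//]]]] ?] //=;
    rewrite /STUV/= /S_ /T_ /U_ /V_ /= !in_itv/= => /andP[? ?] /andP[? ?] *; exfalso; lra.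
- move=> [n k] _; have [_ [ps sr rq qp p8]] := parameters_lt n.
  case: k => [[|[|[|[|//]]]] ?]; rewrite /STUV/= /S_ /T_ /U_ /V_.
  + by exists ((p_pred R n + s_ R n) / 2); rewrite /= in_itv/=; apply/andP; split; lra.
  + by exists (s_ R n); rewrite /= in_itv/=; apply/andP; split; lra.
  + by exists ((r_ R n + q_ R n) / 2); rewrite /= in_itv/=; apply/andP; split; lra.
  + by exists (q_ R n); rewrite /= in_itv/=; apply/andP; split; lra.
Qed.

End parameter_intervals.

(** * Comparison and convergence of the inverse roots *)

Section char_roots_theory.
Context {R : realType}.
Implicit Types (c x y : R) (n : nat).

Lemma charfunE c0 c1 c2 n y : charfun c0 c1 c2 n y =
  y ^+ 3 + c0 * y ^+ (3 * n + 4) + c1 * y ^+ (3 * n + 7) + c2 * y ^+ (3 * n + 10).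
Proof. by rewrite /charfun !exprD; ring. Qed.

(** At [y] the second function already exceeds 1, so by monotonicity its root lies to the left of
    [y]. *)
Lemma charfun_root_lt c0 c1 c2 c0' c1' c2' n y y' :
  0 <= c0' -> 0 < c1' -> 0 <= c2' -> 0 < y < 1 -> 0 < y' < 1 ->
  charfun c0 c1 c2 n y = 1 -> charfun c0' c1' c2' n y' = 1 ->
  c0 + c1 * y ^+ 3 + c2 * y ^+ 6 < c0' + c1' * y ^+ 3 + c2' * y ^+ 6 ->
  y^-1 < y'^-1.
Proof.
move=> c0'0 c1'0 c2'0 /andP[y0 y1] /andP[y'0 y'1] yn yn' cc.
rewrite ltf_pV2// ltNge; apply/negP => yy'.
have : charfun c0 c1 c2 n y < charfun c0' c1' c2' n y.
  by rewrite ltrD2l ltr_pM2l// exprn_gt0.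
rewrite yn -yn' ltNge => /negP; apply.
by move: yy'; rewrite le_eqVlt => /predU1P[->//|/(charfun_lt _ _ _ c0'0 c1'0 c2'0 n _ _ (ltW y0))/ltW].
Qed.

Lemma inv_cvg1 (y : nat -> R) :
  y n @[n --> \oo] --> (1 : R) -> (y n)^-1 @[n --> \oo] --> (1 : R).
Proof. by move=> /(cvgV (oner_neq0 R)); rewrite invr1. Qed.

Lemma inv_decreasing (y : nat -> R) : (forall n, 0 < y n < 1) ->
  (forall n, y n < y n.+1) -> decreasing_seq (fun n => (y n)^-1).
Proof.
move=> y01 yS; apply/decreasing_seqP => n.
by have [/andP[h _] /andP[h' _]] := (y01 n, y01 n.+1); rewrite ltf_pV2//; exact: yS.
Qed.

End char_roots_theory.

(** * Entropy estimates *)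

Section entropy_estimates.
Context {R : realType}.
Implicit Types (b y : R) (n : nat).

Lemma h_F_gt0 b : 4 < b < 8 -> (0 < h_F b)%E.
Proof.
move=> b48; have [n /andP[_ bp]] := p_pred_cover b b48; case/andP: b48 => b4 b8.
have [y [/andP[y0 y1]]] := charfun_root_ex (0 : R) 1 1 (lexx _) ltr01 ler01 n.
rewrite charfunE => yn; apply: (@lt_le_trans _ _ (ln y^-1)%:E).
  by rewrite lte_fin ln_gt0// invf_gt1.
apply: (entropy_ge_phi b b4 b8 n y); first by rewrite y0 ltW.
  by rewrite -le_p.
by rewrite -yn mul0r addr0 !mul1r.
Qed.

(** The equation has a term [y ^+ (3 * n + 7)] more than the return times (3, 3n + 4, 3n + 7)
    require; the bounds by [alpha] and [gamma] likewise drop or add a [y ^+ (3 * n + 10)]. *)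
Lemma h_F_le_beta b n y : 4 < b < 8 -> p_pred R n < b -> 0 < y < 1 ->
  charfun 1 2 0 n y = 1 -> (h_F b <= (ln y^-1)%:E)%E.
Proof.
move=> /andP[b4 b8] pb /andP[y0 y1]; rewrite charfunE => yn.
apply: (entropy_le_S b n y) => //; first by rewrite y0 ltW.
  by rewrite ltW// -p_pred_lt.
by have := exprn_ge0 (3 * n + 7) (ltW y0); lra.
Qed.

Lemma ln_alpha_le_h_F b n y : 4 < b < 8 -> b <= p_ R n -> 0 < y < 1 ->
  charfun 0 1 0 n y = 1 -> ((ln y^-1)%:E <= h_F b)%E.
Proof.
move=> /andP[b4 b8] bp /andP[y0 y1]; rewrite charfunE => yn.
apply: (entropy_ge_phi b b4 b8 n y); first by rewrite y0 ltW.
  by rewrite -le_p.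
by have := exprn_ge0 (3 * n + 10) (ltW y0); lra.
Qed.

Lemma h_F_le_gamma b n y : 4 < b < 8 -> s_ R n <= b -> 0 < y < 1 ->
  charfun 0 2 1 n y = 1 -> (h_F b <= (ln y^-1)%:E)%E.
Proof.
move=> /andP[b4 b8] sb /andP[y0 y1]; rewrite charfunE => yn.
apply: (entropy_le_delta b n y) => //; first by rewrite y0 ltW.
  by rewrite -s_le.
by have := exprn_ge0 (3 * n + 10) (ltW y0); lra.
Qed.

Lemma h_F_eq_delta b n y : 4 < b < 8 -> s_ R n <= b <= r_ R n -> 0 < y < 1 ->
  charfun 0 2 0 n y = 1 -> h_F b = (ln y^-1)%:E.
Proof.
move=> /andP[b4 b8] /andP[sb br] /andP[y0 y1]; rewrite charfunE => yn.
have y01 : 0 < y <= 1 by rewrite y0 ltW.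
apply/eqP; rewrite eq_le; apply/andP; split.
  by apply: (entropy_le_delta b n y) => //; [rewrite -s_le|lra].
by apply: (entropy_ge_delta b b4 b8 n y) => //; [rewrite -le_r|lra].
Qed.

Lemma h_F_eq_phi b n y : 4 < b < 8 -> q_ R n <= b <= p_ R n -> 0 < y < 1 ->
  charfun 0 1 1 n y = 1 -> h_F b = (ln y^-1)%:E.
Proof.
move=> /andP[b4 b8] /andP[qb bp] /andP[y0 y1]; rewrite charfunE => yn.
have y01 : 0 < y <= 1 by rewrite y0 ltW.
apply/eqP; rewrite eq_le; apply/andP; split.
  by apply: (entropy_le_phi b n y) => //; [rewrite -q_le|lra].
by apply: (entropy_ge_phi b b4 b8 n y) => //; [rewrite -le_p|lra].
Qed.

(** The [beta] bound of index [N] holds for every [b] beyond [p_pred R N], so one index controls all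
    parameters near 8. *)
Lemma h_F_small (e : R) : 0 < e -> exists N, forall b, 4 < b < 8 ->
  p_pred R N < b -> (`|h_F b| < e%:E)%E.
Proof.
move=> e0; have [y [yP yS /inv_cvg1 yc]] := charfun_roots (1 : R) 2 0 ler01 (ltr0Sn _ 1) (lexx _).
have e1 : 0 < expR e - 1 by rewrite subr_gt0 expR_gt1.
have /cvgrPdist_lt/(_ _ e1)[N _ hN] := yc; exists N => b b48 pb.
have [/andP[y0 y1] yN] := yP N.
rewrite gee0_abs; last exact/ltW/h_F_gt0.
apply: (le_lt_trans (h_F_le_beta b N _ b48 pb _ yN)); first by rewrite y0.
rewrite lte_fin -ltr_expR lnK ?posrE ?invr_gt0//.
have := hN N (leqnn N); rewrite /= distrC => /(le_lt_trans (ler_norm _)); lra.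
Qed.

End entropy_estimates.

(** * Assembly of the partition, roots, entropy estimates and limits *)

Theorem proposition9 (R : realType) :
  partition [set: nat * 'I_4] (@STUV R) (`]4, 8[%classic) /\
  (forall b : R, 4 < b < 8 -> (0 < h_F b)%E) /\
  (exists alpha beta gamma delta phi : nat -> R,
    (forall n : nat,
      [/\ unique_positive_root
            ('X^(7 + 3 * n) - 'X^(4 + 3 * n) - 1) (alpha n),
          unique_positive_root
            ('X^(7 + 3 * n) - 'X^(4 + 3 * n) - 'X^3 - 2%:P) (beta n),
          unique_positive_root
            ('X^(10 + 3 * n) - 'X^(7 + 3 * n) - 2 *: 'X^3 - 1) (gamma n),
          unique_positive_root
            ('X^(7 + 3 * n) - 'X^(4 + 3 * n) - 2%:P) (delta n) &
          unique_positive_root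
            ('X^(10 + 3 * n) - 'X^(7 + 3 * n) - 'X^3 - 1) (phi n)]) /\
    (forall (n : nat) (b : R),
      [/\ S_ n b ->
            ((ln (alpha n))%:E <= h_F b <= (ln (beta n))%:E)%E,
          T_ n b -> h_F b = (ln (delta n))%:E,
          U_ n b ->
            ((ln (alpha n))%:E <= h_F b <= (ln (gamma n))%:E)%E &
          V_ n b -> h_F b = (ln (phi n))%:E]) /\
    (forall n : nat,
      [/\ 1 < alpha n, alpha n < phi n, phi n < delta n,
          delta n < gamma n & gamma n < beta n]) /\
    [/\ decreasing_seq alpha, decreasing_seq beta, decreasing_seq gamma,
        decreasing_seq delta & decreasing_seq phi] /\
    [/\ (alpha n @[n --> \oo] --> (1 : R)), (beta n @[n --> \oo] --> (1 : R)),
        (gamma n @[n --> \oo] --> (1 : R)), (delta n @[n --> \oo] --> (1 : R)) &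
        (phi n @[n --> \oo] --> (1 : R))]) /\
  (forall e : R, 0 < e -> \forall n \near \oo,
     forall b : R, (S_ n `|` T_ n `|` U_ n `|` V_ n) b ->
       (`|h_F b| < e%:E)%E) /\
  (h_F b @[b --> (8 : R)^'-] --> (0 : \bar R)).
Proof.
have lt02 : 0 < 2 :> R by [].
(* The triples of coefficients come from dividing the five polynomials by their leading power and
   putting [y = 1 / x]; the order is alpha, beta, gamma, delta, phi. *)
have [ya [Pa Sa Ca]] := charfun_roots (0 : R) 1 0 (lexx _) ltr01 (lexx _).
have [yb [Pb Sb Cb]] := charfun_roots (1 : R) 2 0 ler01 lt02 (lexx _).
have [yc [Pc Sc Cc]] := charfun_roots (0 : R) 2 1 (lexx _) lt02 ler01.
have [yd [Pd Sd Cd]] := charfun_roots (0 : R) 2 0 (lexx _) lt02 (lexx _).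
have [yf [Pf Sf Cf]] := charfun_roots (0 : R) 1 1 (lexx _) ltr01 ler01.
split; first exact: STUV_partition.
split; first exact: h_F_gt0.
split.
  exists (fun n => (ya n)^-1), (fun n => (yb n)^-1), (fun n => (yc n)^-1),
    (fun n => (yd n)^-1), (fun n => (yf n)^-1).
  split.
    move=> n; split.
    - have [y01 yn] := Pa n; apply: charfun_unique_positive_root y01 yn _ => // x x0.
      have xN : x != 0 by rewrite gt_eqF.
      exists (x ^+ (7 + 3 * n)); first by rewrite expf_neq0.
      by rewrite !(hornerD, hornerN, hornerZ, hornerXn) ?hornerE charfunE !exprVn !exprD; field; rewrite xN expf_neq0.
    - have [y01 yn] := Pb n; apply: charfun_unique_positive_root y01 yn _ => // x x0.
      have xN : x != 0 by rewrite gt_eqF.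
      exists (x ^+ (7 + 3 * n)); first by rewrite expf_neq0.
      by rewrite !(hornerD, hornerN, hornerZ, hornerXn) ?hornerE charfunE !exprVn !exprD; field; rewrite xN expf_neq0.
    - have [y01 yn] := Pc n; apply: charfun_unique_positive_root y01 yn _ => // x x0.
      have xN : x != 0 by rewrite gt_eqF.
      exists (x ^+ (10 + 3 * n)); first by rewrite expf_neq0.
      rewrite !(hornerD, hornerN) hornerZ !hornerXn hornerC.
      by rewrite charfunE !exprVn !(exprD _ _ (3 * n)) !(exprD _ (3 * n)); field; rewrite xN expf_neq0.
    - have [y01 yn] := Pd n; apply: charfun_unique_positive_root y01 yn _ => // x x0.
      have xN : x != 0 by rewrite gt_eqF.
      exists (x ^+ (7 + 3 * n)); first by rewrite expf_neq0.
      by rewrite !(hornerD, hornerN, hornerZ, hornerXn) ?hornerE charfunE !exprVn !exprD; field; rewrite xN expf_neq0.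
    - have [y01 yn] := Pf n; apply: charfun_unique_positive_root y01 yn _ => // x x0.
      have xN : x != 0 by rewrite gt_eqF.
      exists (x ^+ (10 + 3 * n)); first by rewrite expf_neq0.
      by rewrite !(hornerD, hornerN, hornerZ, hornerXn) ?hornerE charfunE !exprVn !exprD; field; rewrite xN expf_neq0.
  split.
    move=> n b; have [p4 [ps sr rq qp p8]] := parameters_lt (R := R) n.
    have [a01 an] := Pa n; have [b01 bn] := Pb n; have [c01 cn] := Pc n.
    have [d01 dn] := Pd n; have [f01 fn] := Pf n.
    split; rewrite /S_ /T_ /U_ /V_ /= in_itv/= => /andP[lb ub].
    - have b48 : 4 < b < 8 by apply/andP; split; lra.
      apply/andP; split; first by apply: ln_alpha_le_h_F b48 _ a01 an; lra.
      exact: h_F_le_beta b48 lb b01 bn.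
    - have b48 : 4 < b < 8 by apply/andP; split; lra.
      by apply: h_F_eq_delta b48 _ d01 dn; rewrite lb.
    - have b48 : 4 < b < 8 by apply/andP; split; lra.
      apply/andP; split; first by apply: ln_alpha_le_h_F b48 _ a01 an; lra.
      by apply: h_F_le_gamma b48 _ c01 cn; lra.
    - have b48 : 4 < b < 8 by apply/andP; split; lra.
      by apply: h_F_eq_phi b48 _ f01 fn; rewrite lb.
  split.
    move=> n; have [a01 an] := Pa n; have [b01 bn] := Pb n; have [c01 cn] := Pc n.
    have [d01 dn] := Pd n; have [f01 fn] := Pf n.
    (* These give the chain [y^3 < y^3 + y^6 < 2 y^3 < 2 y^3 + y^6 < 1 + 2 y^3], which orders the
       five roots. *)
    have pos (y : R) : 0 < y < 1 -> 0 < y ^+ 3 < 1 /\ 0 < y ^+ 6 < y ^+ 3.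
      move=> /andP[y0 y1]; rewrite !exprn_gt0// exprn_ilt1 ?ltW//=.
      by rewrite ltr_iXn2l.
    split.
    - by case/andP: a01 => a0 a1; rewrite invf_gt1.
    - have [/andP[? ?] /andP[? ?]] := pos _ a01.
      by apply: charfun_root_lt a01 f01 an fn _ => //; lra.
    - have [/andP[? ?] /andP[? ?]] := pos _ f01.
      by apply: charfun_root_lt f01 d01 fn dn _ => //; lra.
    - have [/andP[? ?] /andP[? ?]] := pos _ d01.
      by apply: charfun_root_lt d01 c01 dn cn _ => //; lra.
    - have [/andP[? ?] /andP[? ?]] := pos _ c01.
      by apply: charfun_root_lt c01 b01 cn bn _ => //; lra.
  split; last by split; exact: inv_cvg1.
  by split; apply: inv_decreasing => // n; [case: (Pa n)|case: (Pb n)|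
    case: (Pc n)|case: (Pd n)|case: (Pf n)].
split.
  move=> e /h_F_small[N hN]; exists N => // n /= Nn b STUVb.
  have [k kb] : exists k : 'I_4, STUV (n, k) b.
    case: STUVb => [[[|]|]|] h; [exists (inord 0)|exists (inord 1)|
      exists (inord 2)|exists (inord 3)]; by rewrite /STUV/= inordK.
  have [/andP[pb _] b48] := STUV_bounds _ _ _ kb; apply: hN => //.
  exact: le_lt_trans (p_pred_le _ _ Nn) pb.
have small (e : R) : 0 < e -> \forall b \near (8 : R)^'-, (`|h_F b| < e%:E)%E.
  move=> /h_F_small[N hN]; have [p4 [ps sr rq qp p8]] := parameters_lt (R := R) N.
  have p8' : p_pred R N < 8 by lra.
  near=> b; have pb : p_pred R N < b by near: b; exact: nbhs_left_gt.
  by apply: hN => //; rewrite (le_lt_trans p4 pb); near: b; exact: nbhs_left_lt.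
(* Convergence in [\bar R] needs finiteness near 8, obtained from the bound with [e = 1]. *)
apply/fine_cvgP; split.
  by apply: filterS (small 1 ltr01) => b /lt_le_trans h; rewrite fin_num_abs h// leey.
apply/cvgrPdist_lt => e e0; apply: filterS (small e e0) => b.
by rewrite /= sub0r normrN; case: (h_F b) => [r| |] //=.
Unshelve. all: by end_near. Qed.
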